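(* Let $\mathbf{MHSM}$ be the category of mixed Hodge structures with modulus. (1) Any morphism $f:\mathcal H\to\mathcal H'$ in $\mathbf{MHSM}$, where $\mathcal H=(H,H^\bullet_{\mathrm{add}},H^\bullet_{\mathrm{inf}},\mathcal F^\bullet)$ and $\mathcal H'=(H',H'^\bullet_{\mathrm{add}},H'^\bullet_{\mathrm{inf}},\mathcal F'^\bullet)$, is strict with respect to the Hodge filtration, that is, $f(\mathcal F^k)=\mathcal F'^k\cap f(\mathcal H^k)$ for every $k\in\mathbb Z$. (2) The category $\mathbf{MHSM}$ is an Abelian category.
   Context: $\mathbf{Vec}^\bullet_{\mathbb C}$ is the category of sequences $V^\bullet=(\cdots\to V^k\xrightarrow{\tau^k_V}V^{k-1}\to\cdots)_{k\in\mathbb Z}$ of finite-dimensional $\mathbb C$-vector spaces and linear maps (no condition on compositions) with $V^k=0$ for all but finitely many $k$; morphisms are families of linear maps commuting with the $\tau^k$. $\mathbf{MHS}$ is the category of mixed Hodge structures $H$: a finitely generated abelian group $H_{\mathbb Z}$ with weight filtration $W_\bullet$ on $H_{\mathbb Q}=H_{\mathbb Z}\otimes\mathbb Q$ and Hodge filtration $F^\bullet$ on $H_{\mathbb C}=H_{\mathbb Z}\otimes\mathbb C$. A mixed Hodge structure with modulus is a tuple $\mathcal H=(H,H^\bullet_{\mathrm{add}},H^\bullet_{\mathrm{inf}},\mathcal F^\bullet)$ with $H\in\mathbf{MHS}$, $H^\bullet_{\mathrm{add}},H^\bullet_{\mathrm{inf}}\in\mathbf{Vec}^\bullet_{\mathbb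 C}$, and for each $k\in\mathbb Z$ a linear subspace $\mathcal F^k\subseteq\mathcal H^k:=H_{\mathbb C}\oplus H^k_{\mathrm{add}}\oplus H^k_{\mathrm{inf}}$ such that, with $\tau^k:=\mathrm{Id}\oplus\tau^k_{\mathrm{add}}\oplus\tau^k_{\mathrm{inf}}:\mathcal H^k\to\mathcal H^{k-1}$, for every $k$: (a) $\tau^k(\mathcal F^k)\subseteq\mathcal F^{k-1}$; (b) $x\in H_{\mathbb C}$ lies in $F^kH_{\mathbb C}$ if and only if there is $v\in H^k_{\mathrm{add}}$ with $x+v\in\mathcal F^k$; (c) $\mathcal H^k=\mathcal F^k+H_{\mathbb C}+H^k_{\mathrm{add}}$; (d) $H^k_{\mathrm{add}}\cap\mathcal F^k=0$. A morphism is a morphism in $\mathbf{MHS}\times\mathbf{Vec}^\bullet_{\mathbb C}\times\mathbf{Vec}^\bullet_{\mathbb C}$ such that the induced maps $f:\mathcal H^k\to\mathcal H'^k$ (direct sums of the three components) send $\mathcal F^k$ into $\mathcal F'^k$ for all $k$. *)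

(* Defs.v *)
From HB Require Import structures.
From mathcomp Require Import all_boot all_order all_algebra.
From mathcomp Require Import boolp reals.
From mathcomp.real_closed Require Import complex.
Set Implicit Arguments.
Unset Strict Implicit.
Unset Printing Implicit Defensive.
Import Order.TTheory GRing.Theory Num.Theory.
Local Open Scope ring_scope.
Local Open Scope quotient_scope.

Record category := Category {
  obj :> Type;
  hom : obj -> obj -> Type;
  idm : forall X, hom X X;
  compm : forall X Y Z, hom Y Z -> hom X Y -> hom X Z;
  compm1l : forall X Y (f : hom X Y), compm (idm Y) f = f;
  compm1r : forall X Y (f : hom X Y), compm f (idm X) = f;
  compmA : forall X Y Z T (h : hom Z T) (g : hom Y Z) (f : hom X Y),
    compm h (compm g f) = compm (compm h g) f }.

Arguments hom {c} X Y : rename.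
Arguments idm {c} X : rename.
Arguments compm {c X Y Z} g f : rename.

Notation "g \oc f" := (compm g f) (at level 40, left associativity).

Section CategoryTheory.
Variable C : category.

Record preadditive := Preadditive {
  madd : forall X Y : C, hom X Y -> hom X Y -> hom X Y;
  mopp : forall X Y : C, hom X Y -> hom X Y;
  mzero : forall X Y : C, hom X Y;
  maddA : forall (X Y : C) (f g h : hom X Y),
    madd f (madd g h) = madd (madd f g) h;
  maddC : forall (X Y : C) (f g : hom X Y), madd f g = madd g f;
  madd0m : forall (X Y : C) (f : hom X Y), madd (mzero X Y) f = f;
  maddNm : forall (X Y : C) (f : hom X Y), madd (mopp f) f = mzero X Y;
  compmDl : forall (X Y Z : C) (g h : hom Y Z) (f : hom X Y),
    madd g h \oc f = madd (g \oc f) (h \oc f);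
  compmDr : forall (X Y Z : C) (g : hom Y Z) (f h : hom X Y),
    g \oc madd f h = madd (g \oc f) (g \oc h) }.

Definition monic (X Y : C) (f : hom X Y) : Prop :=
  forall (T : C) (g h : hom T X), f \oc g = f \oc h -> g = h.

Definition epic (X Y : C) (f : hom X Y) : Prop :=
  forall (T : C) (g h : hom Y T), g \oc f = h \oc f -> g = h.

Definition zero_object (Z : C) : Prop :=
  forall X : C, (exists! f : hom Z X, True) /\ (exists! f : hom X Z, True).

Section Preadditive.
Variable A : preadditive.

Definition biproduct (X Y B : C) : Prop :=
  exists (i1 : hom X B) (i2 : hom Y B) (p1 : hom B X) (p2 : hom B Y),
    [/\ p1 \oc i1 = idm X, p2 \oc i2 = idm Y
      & madd A (i1 \oc p1) (i2 \oc p2) = idm B].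

Definition kernel (X Y : C) (f : hom X Y) (K : C) (k : hom K X) : Prop :=
  f \oc k = mzero A K Y /\
  forall (T : C) (g : hom T X), f \oc g = mzero A T Y ->
    exists! u : hom T K, k \oc u = g.

Definition cokernel (X Y : C) (f : hom X Y) (Q : C) (q : hom Y Q) : Prop :=
  q \oc f = mzero A X Q /\
  forall (T : C) (g : hom Y T), g \oc f = mzero A X T ->
    exists! u : hom Q T, u \oc q = g.

Definition abelian_for : Prop :=
  (exists Z : C, zero_object Z) /\
  (forall X Y : C, exists B : C, biproduct X Y B) /\
  (forall (X Y : C) (f : hom X Y), exists (K : C) (k : hom K X), kernel f k) /\
  (forall (X Y : C) (f : hom X Y), exists (Q : C) (q : hom Y Q), cokernel f q) /\
  (forall (X Y : C) (f : hom X Y), monic f ->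
     exists (Z : C) (g : hom Y Z), kernel g f) /\
  (forall (X Y : C) (f : hom X Y), epic f ->
     exists (Z : C) (g : hom Z X), cokernel g f).

End Preadditive.

(* In an abelian category the group structure on the morphism sets is
   determined by the underlying category, so it is quantified existentially. *)
Definition abelian_category : Prop := exists A : preadditive, abelian_for A.

End CategoryTheory.

Definition biadditive (M K V : zmodType) (b : M -> K -> V) : Prop :=
  (forall m n a, b (m + n) a = b m a + b n a) /\
  (forall m a c, b m (a + c) = b m a + b m c).

Section Tensor.
Variables (M : zmodType) (K : fieldType).

(* A list [:: (m_1, a_1); ...; (m_r, a_r)] stands for the formal sum of the
   m_i (x) a_i. Two formal sums are identified when no biadditive map to an
   abelian group separates them; the universal property is [tens_universal]. *)
Definition tens_eq (s t : seq (M * K)) : Prop :=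
  forall (V : zmodType) (b : M -> K -> V), biadditive b ->
    \sum_(p <- s) b p.1 p.2 = \sum_(p <- t) b p.1 p.2.

Definition tens_rel : rel (seq (M * K)) := fun s t => `[< tens_eq s t >].

Fact tens_rel_equiv : equiv_class_of tens_rel.
Proof.
split=> [s|s t|t s u].
- exact/asboolP.
- by apply/asboolP/asboolP => st V b bb; rewrite st.
- by move=> /asboolP st /asboolP tu; apply/asboolP=> V b bb; rewrite st ?tu.
Qed.

Canonical tens_rel_canonical := EquivRelPack tens_rel_equiv.

Definition tens := {eq_quot tens_rel}.
HB.instance Definition _ := Choice.on tens.

Definition tens_pi (s : seq (M * K)) : tens := \pi_({eq_quot tens_rel}) s.

Lemma tens_piP s t : tens_eq s t <-> tens_pi s = tens_pi t.
Proof.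
split=> [st|/eqmodP/asboolP //].
by apply/eqmodP/asboolP.
Qed.

Lemma tens_reprP s : tens_eq (repr (tens_pi s)) s.
Proof. by apply/tens_piP; rewrite /tens_pi reprK. Qed.

Lemma tens_piK (x : tens) : tens_pi (repr x) = x.
Proof. exact: reprK. Qed.

Definition tens_add (x y : tens) : tens := tens_pi (repr x ++ repr y).
Definition tens_opp (x : tens) : tens :=
  tens_pi [seq (- p.1, p.2) | p <- repr x].
Definition tens_scale (a : K) (x : tens) : tens :=
  tens_pi [seq (p.1, a * p.2) | p <- repr x].

Lemma biadd0l (V : zmodType) (b : M -> K -> V) a : biadditive b -> b 0 a = 0.
Proof.
by case=> bD _; apply/(addrI (b 0 a)); rewrite -bD !addr0.
Qed.

Lemma biaddNl (V : zmodType) (b : M -> K -> V) m a :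
  biadditive b -> b (- m) a = - b m a.
Proof.
move=> bb; apply/(addrI (b m a)).
by rewrite -(proj1 bb) !subrr biadd0l.
Qed.

Lemma biadd_scale (V : zmodType) (b : M -> K -> V) a :
  biadditive b -> biadditive (fun m c => b m (a * c)).
Proof. by case=> bl br; split=> *; rewrite ?bl// mulrDr br. Qed.

Lemma tens_addE s t : tens_add (tens_pi s) (tens_pi t) = tens_pi (s ++ t).
Proof.
by apply/tens_piP => V b bb; rewrite !big_cat !(tens_reprP _ bb).
Qed.

Lemma tens_oppE s : tens_opp (tens_pi s) = tens_pi [seq (- p.1, p.2) | p <- s].
Proof.
apply/tens_piP => V b bb; rewrite !big_map /=.
rewrite !(eq_bigr _ (fun p _ => biaddNl p.1 p.2 bb)) !sumrN.
by rewrite (tens_reprP _ bb).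
Qed.

Lemma tens_scaleE a s :
  tens_scale a (tens_pi s) = tens_pi [seq (p.1, a * p.2) | p <- s].
Proof.
apply/tens_piP => V b bb; rewrite !big_map /=.
exact: (tens_reprP _ (biadd_scale a bb)).
Qed.

Lemma tens_piW (P : tens -> Prop) : (forall s, P (tens_pi s)) -> forall x, P x.
Proof. by move=> Ps x; rewrite -[x]tens_piK. Qed.

Fact tens_addA : associative tens_add.
Proof.
elim/tens_piW=> s; elim/tens_piW=> t; elim/tens_piW=> u.
by rewrite !tens_addE catA.
Qed.

Fact tens_addC : commutative tens_add.
Proof.
elim/tens_piW=> s; elim/tens_piW=> t; rewrite !tens_addE.
by apply/tens_piP => V b bb; rewrite !big_cat /= addrC.
Qed.

Fact tens_add0 : left_id (tens_pi [::]) tens_add.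
Proof. by elim/tens_piW=> s; rewrite tens_addE. Qed.

Fact tens_addN : left_inverse (tens_pi [::]) tens_opp tens_add.
Proof.
elim/tens_piW=> s; rewrite tens_oppE tens_addE.
apply/tens_piP => V b bb; rewrite big_cat big_map big_nil /=.
by rewrite (eq_bigr _ (fun p _ => biaddNl p.1 p.2 bb)) sumrN addNr.
Qed.

HB.instance Definition _ :=
  GRing.isZmodule.Build tens tens_addA tens_addC tens_add0 tens_addN.

Lemma tens_piD s t : tens_pi (s ++ t) = tens_pi s + tens_pi t.
Proof. by rewrite -tens_addE. Qed.

Fact tens_scaleA a b x : tens_scale a (tens_scale b x) = tens_scale (a * b) x.
Proof.
elim/tens_piW: x => s; rewrite !tens_scaleE -map_comp; congr tens_pi.
by apply/eq_map => p /=; rewrite mulrA.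
Qed.

Fact tens_scale1 : left_id 1 tens_scale.
Proof.
elim/tens_piW=> s; rewrite tens_scaleE; congr tens_pi.
by rewrite -[RHS]map_id; apply/eq_map => -[m a] /=; rewrite mul1r.
Qed.

Fact tens_scaleDr : right_distributive tens_scale +%R.
Proof.
move=> a; elim/tens_piW=> s; elim/tens_piW=> t.
by rewrite -tens_piD !tens_scaleE -tens_piD map_cat.
Qed.

Fact tens_scaleDl x : {morph tens_scale^~ x : a b / a + b}.
Proof.
elim/tens_piW: x => s a c; rewrite !tens_scaleE -tens_piD.
apply/tens_piP => V b bb; rewrite big_cat !big_map /= -big_split /=.
by apply/eq_bigr => p _; rewrite mulrDl (proj2 bb).
Qed.

HB.instance Definition _ := GRing.Zmodule_isLmodule.Build K tens
  tens_scaleA tens_scale1 tens_scaleDr tens_scaleDl.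

Definition pure_tens (m : M) (a : K) : tens := tens_pi [:: (m, a)].

Lemma pure_tens_biadd : biadditive pure_tens.
Proof.
split=> *; rewrite -tens_piD; apply/tens_piP => V b bb;
  rewrite /= !(big_cons, big_nil) !addr0 /=.
- exact: (proj1 bb).
- exact: (proj2 bb).
Qed.

Lemma tens_piE s : tens_pi s = \sum_(p <- s) pure_tens p.1 p.2.
Proof.
elim: s => [|[m a] s IHs]; first by rewrite big_nil.
by rewrite big_cons -IHs -tens_piD.
Qed.

Lemma scale_pure_tens a m c : a *: pure_tens m c = pure_tens m (a * c).
Proof. exact: (tens_scaleE a [:: (m, c)]). Qed.

Definition tens_rec (V : zmodType) (b : M -> K -> V) (x : tens) : V :=
  \sum_(p <- repr x) b p.1 p.2.

Lemma tens_rec_pi (V : zmodType) (b : M -> K -> V) s : biadditive b ->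
  tens_rec b (tens_pi s) = \sum_(p <- s) b p.1 p.2.
Proof. by move=> bb; apply: tens_reprP. Qed.

Lemma tens_rec_pure (V : zmodType) (b : M -> K -> V) m a : biadditive b ->
  tens_rec b (pure_tens m a) = b m a.
Proof. by move=> bb; rewrite tens_rec_pi // big_seq1. Qed.

Lemma tens_recD (V : zmodType) (b : M -> K -> V) : biadditive b ->
  {morph tens_rec b : x y / x + y}.
Proof.
move=> bb; elim/tens_piW=> s; elim/tens_piW=> t.
by rewrite -tens_piD !tens_rec_pi // big_cat.
Qed.

Lemma tens_ind (P : tens -> Prop) : P 0 ->
  (forall m a x, P x -> P (pure_tens m a + x)) -> forall x, P x.
Proof.
move=> P0 PD; elim/tens_piW=> s; rewrite tens_piE.
by elim: s => [|p s IHs]; rewrite ?big_nil // big_cons; apply: PD.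
Qed.

Lemma tens_universal (V : zmodType) (b : M -> K -> V) : biadditive b ->
  exists! f : tens -> V,
    {morph f : x y / x + y} /\ forall m a, f (pure_tens m a) = b m a.
Proof.
move=> bb; exists (tens_rec b); split.
  by split=> [|m a]; [apply: tens_recD | apply: tens_rec_pure].
move=> f [fD fb]; apply/funext; elim/tens_ind=> [|m a x IHx].
  apply/(addrI (tens_rec b 0)); rewrite -tens_recD // !addr0.
  have f0 : f 0 = 0 by apply/(addrI (f 0)); rewrite -fD !addr0.
  have r0 : tens_rec b 0 = 0.
    by apply/(addrI (tens_rec b 0)); rewrite -tens_recD // !addr0.
  by rewrite r0 f0 addr0.
by rewrite fD fb -IHx tens_recD // tens_rec_pure.
Qed.

End Tensor.

Section TensorMap.
Variables (M N : zmodType) (K L : fieldType).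
Variables (f : {additive M -> N}) (g : {additive K -> L}).

Definition tens_map (x : tens M K) : tens N L :=
  tens_rec (fun m a => pure_tens (f m) (g a)) x.

Lemma tens_map_biadd : biadditive (fun m a => pure_tens (f m) (g a)).
Proof.
have [Dl Dr] := pure_tens_biadd N L.
by split=> *; rewrite raddfD ?Dl ?Dr.
Qed.

Lemma tens_map_pure m a : tens_map (pure_tens m a) = pure_tens (f m) (g a).
Proof. exact: tens_rec_pure tens_map_biadd. Qed.

Lemma tens_mapD : {morph tens_map : x y / x + y}.
Proof. exact: tens_recD tens_map_biadd. Qed.

Fact tens_map_is_nmod : nmod_morphism tens_map.
Proof.
split; last exact: tens_mapD.
by apply/(addrI (tens_map 0)); rewrite -tens_mapD !addr0.
Qed.

HB.instance Definition _ := GRing.isNmodMorphism.Build _ _ tens_map tens_map_is_nmod.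
End TensorMap.

Section TensorMapLinear.
Variables (M N : zmodType) (K : fieldType) (f : {additive M -> N}).

Definition tens_mapl (x : tens M K) : tens N K := tens_map f idfun x.

Fact tens_mapl_linear : linear tens_mapl.
Proof.
move=> a x y; rewrite /tens_mapl raddfD; congr (_ + _).
elim/tens_ind: x => [|m c x IHx]; first by rewrite !(scaler0, raddf0).
rewrite scalerDr !raddfD /= IHx; congr (_ + _).
by rewrite scale_pure_tens !tens_map_pure scale_pure_tens.
Qed.

HB.instance Definition _ :=
  GRing.isLinear.Build K _ _ _ tens_mapl tens_mapl_linear.

Lemma tens_mapl_pure m a : tens_mapl (pure_tens m a) = pure_tens (f m) a.
Proof. exact: tens_map_pure. Qed.
End TensorMapLinear.

HB.mixin Record Zmodule_isFinGen M of GRing.Zmodule M := {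
  fin_gen : exists s : seq M, forall x : M, exists c : 'I_(size s) -> int,
    x = \sum_(i < size s) s`_i *~ c i }.

#[short(type="fgZmodType")]
HB.structure Definition FGZmod := { M of Zmodule_isFinGen M & GRing.Zmodule M }.

Section FinDim.
Variables (K : fieldType) (V : lmodType K).

Lemma span_vector_axiom (n : nat) (e : 'I_n -> V) :
  (forall v, exists c : 'rV[K]_n, v = \sum_i c 0 i *: e i) ->
  exists d, inhabited (Vector.axiom d V).
Proof.
elim: n e => [|n IHn] e eV.
  exists 0%N; constructor; exists (fun _ => 0).
    by move=> a x y; rewrite scaler0 addr0.
  exists (fun _ => 0) => [v|r]; last by apply/rowP; case.
  by have [c ->] := eV v; rewrite big_ord0.
have [[c [c0 ce]]|free] :=
    pselect (exists c : 'rV[K]_n.+1, c != 0 /\ \sum_i c 0 i *: e i = 0).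
  have /existsP [j cj] : [exists j, c 0 j != 0].
    apply/existsPn => h; case/eqP: c0; apply/rowP => i.
    by have := h i; rewrite negbK mxE => /eqP.
  apply: (IHn (fun i => e (lift j i))) => v; have [r ->] := eV v.
  have ej : e j = \sum_i (- ((c 0 j)^-1 * c 0 (lift j i))) *: e (lift j i).
    move: ce; rewrite (bigD1_ord j) //= => /eqP; rewrite addr_eq0 => /eqP ce.
    rewrite -[LHS](scalerK (cj : (c 0 j) != 0)) ce scalerN scaler_sumr -sumrN.
    by apply/eq_bigr => i _; rewrite scalerA scaleNr.
  exists (\row_i (r 0 (lift j i)
           - r 0 j * ((c 0 j)^-1 * c 0 (lift j i)))).
  rewrite (bigD1_ord j) //= ej scaler_sumr -big_split /=.
  by apply/eq_bigr => i _; rewrite mxE scalerA -scalerDl addrC mulrN.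
have [f fE] := choice eV.
pose g (c : 'rV[K]_n.+1) := \sum_i c 0 i *: e i.
have gD a x y : g (a *: x + y) = a *: g x + g y.
  rewrite /g scaler_sumr -big_split /=; apply/eq_bigr => i _.
  by rewrite !mxE scalerDl scalerA.
have gI : injective g.
  move=> x y gxy; apply/eqP; rewrite -subr_eq0; apply/negPn/negP => xy.
  apply: free; exists (x - y); split=> //.
  have := gD (-1) y x; rewrite -/(g _) scaleN1r addrC => ->.
  by rewrite gxy scaleN1r addNr.
have fK v : g (f v) = v by rewrite [RHS]fE.
exists n.+1; constructor; exists f.
  by move=> a x y; apply: gI; rewrite gD !fK.
by exists g => [v|r]; [apply: fK | apply: gI; rewrite fK].
Qed.

End FinDim.

Section TensorFinDim.
Variables (M : fgZmodType) (K : fieldType).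

Lemma tens_fin_dim : exists d, inhabited (Vector.axiom d (tens M K)).
Proof.
have [s sM] := @fin_gen M.
apply: (@span_vector_axiom K _ (size s) (fun i => pure_tens s`_i 1)) => v.
have [Dl Dr] := pure_tens_biadd M K.
elim/tens_ind: v => [|m a x [r ->]].
  by exists 0; rewrite big1 // => i _; rewrite mxE scale0r.
have [c ->] := sM m.
have pureD : {morph (fun m : M => pure_tens m a) : x y / x + y}.
  by move=> ? ?; rewrite Dl.
have pure0 : pure_tens (0 : M) a = 0 by exact: biadd0l (pure_tens_biadd M K).
pose p := fun m : M => pure_tens m a.
have pA : nmod_morphism p by split.
pose pH := HB.pack_for {additive M -> tens M K} p
  (GRing.isNmodMorphism.Build _ _ p pA).
exists (\row_i ((c i)%:~R * a + r 0 i)).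
have -> : pure_tens (\sum_(i < size s) s`_i *~ c i) a
       = \sum_(i < size s) ((c i)%:~R * a) *: pure_tens s`_i 1.
  rewrite -[LHS]/(pH _) raddf_sum; apply/eq_bigr => i _.
  rewrite raddfMz /= /p -scaler_int -[in LHS](mulr1 a) -scale_pure_tens.
  by rewrite scalerA.
rewrite -big_split /=; apply/eq_bigr => i _.
by rewrite mxE scalerDl.
Qed.

Let dT := projT1 (cid tens_fin_dim).
Let dTP : Vector.axiom dT (tens M K).
Proof. by rewrite /dT; case: cid => d /= /inhabited_witness. Qed.

HB.instance Definition _ := Lmodule_hasFinDim.Build K (tens M K) dTP.
End TensorFinDim.

Section MHS.
Variable R : realType.
Local Notation C := (R[i]).

Section Scalars.
Variable M : fgZmodType.

Definition tens_ratC (x : tens M rat) : tens M C :=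
  tens_map (@idfun M) (@ratr C) x.

Definition tens_conj (x : tens M C) : tens M C :=
  tens_map (@idfun M) (@Num.conj C) x.

(* The C-span of the image of W in H_C, i.e. W (x)_Q C. *)
Definition complexify (W : {vspace tens M rat}) : {vspace tens M C} :=
  <<map tens_ratC (vbasis W)>>%VS.

(* The image of U under complex conjugation, see [memv_conj]. *)
Definition conjv (U : {vspace tens M C}) : {vspace tens M C} :=
  <<map tens_conj (vbasis U)>>%VS.

Lemma tens_conjD : {morph tens_conj : x y / x + y}.
Proof. exact: tens_mapD. Qed.

Lemma tens_conj0 : tens_conj 0 = 0.
Proof. exact: (raddf0 (tens_map (@idfun M) (@Num.conj C))). Qed.

Lemma tens_conj_pure m a : tens_conj (pure_tens m a) = pure_tens m (Num.conj a).
Proof. exact: (tens_map_pure (@idfun M) (@Num.conj C)). Qed.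

Lemma tens_conjZ a x : tens_conj (a *: x) = Num.conj a *: tens_conj x.
Proof.
elim/tens_ind: x => [|m c x IHx]; first by rewrite scaler0 tens_conj0 scaler0.
rewrite scalerDr !tens_conjD IHx scalerDr; congr (_ + _).
by rewrite scale_pure_tens !tens_conj_pure scale_pure_tens rmorphM.
Qed.

Lemma tens_conjK : involutive tens_conj.
Proof.
elim/tens_ind => [|m c x IHx]; first by rewrite !tens_conj0.
by rewrite !tens_conjD IHx !tens_conj_pure conjCK.
Qed.

Lemma memv_conj (U : {vspace tens M C}) x : (tens_conj x \in conjv U) = (x \in U).
Proof.
have sub (V : {vspace tens M C}) (s : seq (tens M C)) y :
    {in s, forall z, tens_conj z \in V} -> y \in <<s>>%VS -> tens_conj y \in V.
  move=> sV; rewrite -[s]/(val (in_tuple s)) => /coord_span ->.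
  rewrite (big_morph _ tens_conjD tens_conj0); apply: memv_suml => i _.
  by rewrite tens_conjZ memvZ // sV // mem_nth.
apply/idP/idP.
  rewrite -{2}[x]tens_conjK; apply: sub => z /mapP [y yU ->].
  by rewrite tens_conjK; apply: vbasis_mem.
rewrite -{1}(span_basis (vbasisP U)); apply: sub => z zU.
by apply/memv_span/map_f.
Qed.

End Scalars.

Section Graded.
Variables (M : fgZmodType) (W : int -> {vspace tens M rat}).
Variable F : int -> {vspace tens M C}.

(* The inverse image in W_n H_C of the subspace F^p Gr^W_n H_C of
   Gr^W_n H_C = W_n H_C / W_{n-1} H_C. *)
Definition hodge_gr (n p : int) : {vspace tens M C} :=
  ((F p :&: complexify (W n)) + complexify (W (n - 1)))%VS.

(* The filtration induced by F on Gr^W_n is a pure Hodge structure of weight n: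
   Gr = F^p Gr (+) conj (F^q Gr) whenever p + q = n + 1, written in terms of
   the subspaces of W_n H_C containing W_{n-1} H_C. *)
Definition pure_gr (n : int) : Prop := forall p q : int, p + q = n + 1 ->
  (hodge_gr n p + conjv (hodge_gr n q) = complexify (W n))%VS /\
  (hodge_gr n p :&: conjv (hodge_gr n q) = complexify (W (n - 1)))%VS.

End Graded.

Record mhs := MHS {
  HZ : fgZmodType;
  weight : int -> {vspace tens HZ rat};
  hodge : int -> {vspace tens HZ C};
  weight_incr : forall m n, m <= n -> (weight m <= weight n)%VS;
  weight_bot : exists n, weight n = 0%VS;
  weight_top : exists n, weight n = fullv;
  hodge_decr : forall p q, p <= q -> (hodge q <= hodge p)%VS;
  hodge_top : exists p, hodge p = fullv;
  hodge_bot : exists p, hodge p = 0%VS;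
  gr_pure : forall n, pure_gr weight hodge n }.

Definition HQ (H : mhs) : vectType rat := tens (HZ H) rat.
Definition HC (H : mhs) : vectType C := tens (HZ H) C.

Definition tens_lfun (K : fieldType) (M N : fgZmodType) (f : {additive M -> N}) :
  'Hom(tens M K, tens N K) := linfun (tens_mapl f).

Record mhs_hom (H H' : mhs) := MHSHom {
  fZ : {additive HZ H -> HZ H'};
  fZ_weight : forall n, (tens_lfun rat fZ @: weight H n <= weight H' n)%VS;
  fZ_hodge : forall p, (tens_lfun C fZ @: hodge H p <= hodge H' p)%VS }.

Definition fC (H H' : mhs) (f : mhs_hom H H') : 'Hom(HC H, HC H') :=
  tens_lfun C (fZ f).

Record vecs := Vecs {
  vec : int -> vectType C;
  vtau : forall k, 'Hom(vec k, vec (k - 1));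
  vec_bounded : exists s : seq int, forall k, k \notin s ->
    (fullv : {vspace vec k}) = 0%VS }.

Record vecs_hom (V V' : vecs) := VecsHom {
  vmap : forall k, 'Hom(vec V k, vec V' k);
  vmap_tau : forall k, (vmap (k - 1) \o vtau V k = vtau V' k \o vmap k)%VF }.

Section DirectSum.
Variables U1 U2 U3 V1 V2 V3 : vectType C.

Definition dsum (f1 : 'Hom(U1, V1)) (f2 : 'Hom(U2, V2)) (f3 : 'Hom(U3, V3)) :
    'Hom((U1 * U2 * U3)%type, (V1 * V2 * V3)%type) :=
  linfun (fun x : U1 * U2 * U3 => (f1 x.1.1, f2 x.1.2, f3 x.2)).

Lemma dsumE f1 f2 f3 x : dsum f1 f2 f3 x = (f1 x.1.1, f2 x.1.2, f3 x.2).
Proof.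
pose g (x : U1 * U2 * U3) := (f1 x.1.1, f2 x.1.2, f3 x.2).
have gL : linear g by move=> a u v; rewrite /g /= !linearP.
pose gH := HB.pack_for {linear (U1 * U2 * U3)%type -> (V1 * V2 * V3)%type} g
  (GRing.isLinear.Build C _ _ _ g gL).
exact: (lfunE gH).
Qed.
End DirectSum.

Definition mhsm_space (H : mhs) (Hadd Hinf : vecs) (k : int) : vectType C :=
  (HC H * vec Hadd k * vec Hinf k)%type.

Definition mhsm_tau (H : mhs) (Hadd Hinf : vecs) (k : int) :
    'Hom(mhsm_space H Hadd Hinf k, mhsm_space H Hadd Hinf (k - 1)) :=
  dsum \1%VF (vtau Hadd k) (vtau Hinf k).

(* H_C and H_add^k as subspaces of H_C (+) H_add^k (+) H_inf^k. *)
Definition sub_HC (H : mhs) (Hadd Hinf : vecs) k :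
    {vspace mhsm_space H Hadd Hinf k} :=
  limg (dsum (\1%VF : 'End(HC H)) (0 : 'End(vec Hadd k)) (0 : 'End(vec Hinf k))).
Definition sub_add (H : mhs) (Hadd Hinf : vecs) k :
    {vspace mhsm_space H Hadd Hinf k} :=
  limg (dsum (0 : 'End(HC H)) (\1%VF : 'End(vec Hadd k)) (0 : 'End(vec Hinf k))).

Record mhsm := MHSM {
  mhsm_H : mhs;
  mhsm_add : vecs;
  mhsm_inf : vecs;
  mhsm_F : forall k, {vspace mhsm_space mhsm_H mhsm_add mhsm_inf k};
  mhsm_F_tau : forall k,
    (mhsm_tau mhsm_H mhsm_add mhsm_inf k @: mhsm_F k <= mhsm_F (k - 1))%VS;
  mhsm_F_hodge : forall k (x : HC mhsm_H),
    x \in hodge mhsm_H k <->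
    exists v : vec mhsm_add k, (x, v, 0 : vec mhsm_inf k) \in mhsm_F k;
  mhsm_F_full : forall k,
    fullv = (mhsm_F k + sub_HC mhsm_H mhsm_add mhsm_inf k
             + sub_add mhsm_H mhsm_add mhsm_inf k)%VS;
  mhsm_F_add : forall k,
    (sub_add mhsm_H mhsm_add mhsm_inf k :&: mhsm_F k = 0)%VS }.

Definition mhsm_total (X : mhsm) (k : int) : vectType C :=
  mhsm_space (mhsm_H X) (mhsm_add X) (mhsm_inf X) k.

Definition total_map (X Y : mhsm) (fH : mhs_hom (mhsm_H X) (mhsm_H Y))
    (fadd : vecs_hom (mhsm_add X) (mhsm_add Y))
    (finf : vecs_hom (mhsm_inf X) (mhsm_inf Y)) (k : int) :
    'Hom(mhsm_total X k, mhsm_total Y k) :=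
  dsum (fC fH) (vmap fadd k) (vmap finf k).

Record mhsm_hom (X Y : mhsm) := MHSMHom {
  hom_H : mhs_hom (mhsm_H X) (mhsm_H Y);
  hom_add : vecs_hom (mhsm_add X) (mhsm_add Y);
  hom_inf : vecs_hom (mhsm_inf X) (mhsm_inf Y);
  hom_F : forall k,
    (total_map hom_H hom_add hom_inf k @: mhsm_F X k <= mhsm_F Y k)%VS }.

Definition mhsm_map (X Y : mhsm) (f : mhsm_hom X Y) (k : int) :
    'Hom(mhsm_total X k, mhsm_total Y k) :=
  total_map (hom_H f) (hom_add f) (hom_inf f) k.

Lemma tens_lfun_id K (M : fgZmodType) : tens_lfun K (@idfun M) = \1%VF.
Proof.
apply/lfunP => x; rewrite lfunE id_lfunE.
elim/tens_ind: x => [|m a x IHx]; first by rewrite raddf0.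
by rewrite raddfD /= IHx tens_mapl_pure.
Qed.

Lemma tens_lfun_comp K (M N P : fgZmodType) (g : {additive N -> P})
    (f : {additive M -> N}) :
  tens_lfun K (g \o f) = (tens_lfun K g \o tens_lfun K f)%VF.
Proof.
apply/lfunP => x; rewrite lfunE comp_lfunE !lfunE /=.
elim/tens_ind: x => [|m a x IHx]; first by rewrite !raddf0.
by rewrite !raddfD /= IHx !tens_mapl_pure.
Qed.

Lemma mhs_hom_eq (H H' : mhs) (f g : mhs_hom H H') : fZ f =1 fZ g -> f = g.
Proof.
case: f g => [f fW fF] [g gW gF] /= fg.
have {}fg : f = g.
  case: f g fg {fW fF gW gF} => [f [[fP]]] [g [[gP]]] /= fg.
  have E : f = g by apply/funext => x; exact: fg.
  subst g.
  by rewrite (Prop_irrelevance fP gP).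
subst g; congr MHSHom; exact: Prop_irrelevance.
Qed.

Lemma vecs_hom_eq (V V' : vecs) (f g : vecs_hom V V') :
  (forall k, vmap f k = vmap g k) -> f = g.
Proof.
case: f g => [f fP] [g gP] /= fg.
have E : f = g by apply: functional_extensionality_dep.
subst g; congr VecsHom; exact: Prop_irrelevance.
Qed.

Lemma mhsm_hom_eq (X Y : mhsm) (f g : mhsm_hom X Y) :
  hom_H f = hom_H g -> hom_add f = hom_add g -> hom_inf f = hom_inf g -> f = g.
Proof.
case: f g => [fH fa fi fF] [gH ga gi gF] /= ? ? ?; subst.
congr MHSMHom; exact: Prop_irrelevance.
Qed.

Fact mhs_id_sub (H : mhs) K (U : {vspace tens (HZ H) K}) :
  (tens_lfun K (@idfun (HZ H)) @: U <= U)%VS.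
Proof. by rewrite tens_lfun_id lim1g. Qed.

Definition mhs_id (H : mhs) : mhs_hom H H :=
  @MHSHom H H (@idfun (HZ H)) (fun n => mhs_id_sub _) (fun p => mhs_id_sub _).

Fact mhs_comp_sub (H H' H'' : mhs) (g : {additive HZ H' -> HZ H''})
    (f : {additive HZ H -> HZ H'}) K (U : {vspace tens (HZ H) K})
    (U' : {vspace tens (HZ H') K}) (U'' : {vspace tens (HZ H'') K}) :
  (tens_lfun K f @: U <= U')%VS -> (tens_lfun K g @: U' <= U'')%VS ->
  (tens_lfun K (g \o f)%FUN @: U <= U'')%VS.
Proof.
move=> fU gU; rewrite tens_lfun_comp limg_comp.
exact: subv_trans (limgS _ fU) gU.
Qed.

Definition mhs_comp (H H' H'' : mhs) (g : mhs_hom H' H'') (f : mhs_hom H H') :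
    mhs_hom H H'' :=
  @MHSHom H H'' (fZ g \o fZ f)
    (fun n => mhs_comp_sub (fZ_weight f n) (fZ_weight g n))
    (fun p => mhs_comp_sub (fZ_hodge f p) (fZ_hodge g p)).

Fact vecs_id_tau (V : vecs) k : (\1 \o vtau V k = vtau V k \o \1)%VF.
Proof. by rewrite comp_lfun1l comp_lfun1r. Qed.

Definition vecs_id (V : vecs) : vecs_hom V V := VecsHom (vecs_id_tau V).

Fact vecs_comp_tau (V V' V'' : vecs) (g : vecs_hom V' V'') (f : vecs_hom V V') k :
  ((vmap g (k - 1) \o vmap f (k - 1)) \o vtau V k
   = vtau V'' k \o (vmap g k \o vmap f k))%VF.
Proof. by rewrite -comp_lfunA vmap_tau !comp_lfunA vmap_tau. Qed.

Definition vecs_comp (V V' V'' : vecs) (g : vecs_hom V' V'') (f : vecs_hom V V') :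
    vecs_hom V V'' :=
  @VecsHom V V'' (fun k => (vmap g k \o vmap f k)%VF) (vecs_comp_tau g f).

Fact mhsm_id_F (X : mhsm) k :
  (total_map (mhs_id (mhsm_H X)) (vecs_id (mhsm_add X)) (vecs_id (mhsm_inf X)) k
   @: mhsm_F X k <= mhsm_F X k)%VS.
Proof.
suff -> : total_map (mhs_id (mhsm_H X)) (vecs_id (mhsm_add X))
    (vecs_id (mhsm_inf X)) k = \1%VF by rewrite lim1g.
apply/lfunP => -[[x v] w].
by rewrite dsumE /fC /= tens_lfun_id !id_lfunE.
Qed.

Definition mhsm_id (X : mhsm) : mhsm_hom X X := MHSMHom (@mhsm_id_F X).

Fact mhsm_comp_F (X Y Z : mhsm) (g : mhsm_hom Y Z) (f : mhsm_hom X Y) k :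
  (total_map (mhs_comp (hom_H g) (hom_H f)) (vecs_comp (hom_add g) (hom_add f))
     (vecs_comp (hom_inf g) (hom_inf f)) k @: mhsm_F X k <= mhsm_F Z k)%VS.
Proof.
suff -> : total_map (mhs_comp (hom_H g) (hom_H f))
    (vecs_comp (hom_add g) (hom_add f)) (vecs_comp (hom_inf g) (hom_inf f)) k
  = (mhsm_map g k \o mhsm_map f k)%VF.
  by rewrite limg_comp; apply: subv_trans (limgS _ (hom_F f k)) (hom_F g k).
apply/lfunP => -[[x v] w].
by rewrite comp_lfunE !dsumE /fC /= tens_lfun_comp !comp_lfunE.
Qed.

Definition mhsm_comp (X Y Z : mhsm) (g : mhsm_hom Y Z) (f : mhsm_hom X Y) :
    mhsm_hom X Z := MHSMHom (mhsm_comp_F g f).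

Fact mhsm_comp1m (X Y : mhsm) (f : mhsm_hom X Y) : mhsm_comp (mhsm_id Y) f = f.
Proof.
apply: mhsm_hom_eq => /=; [exact: mhs_hom_eq| |];
  by apply: vecs_hom_eq => k /=; rewrite comp_lfun1l.
Qed.

Fact mhsm_compm1 (X Y : mhsm) (f : mhsm_hom X Y) : mhsm_comp f (mhsm_id X) = f.
Proof.
apply: mhsm_hom_eq => /=; [exact: mhs_hom_eq| |];
  by apply: vecs_hom_eq => k /=; rewrite comp_lfun1r.
Qed.

Fact mhsm_compA (X Y Z T : mhsm) (h : mhsm_hom Z T) (g : mhsm_hom Y Z)
    (f : mhsm_hom X Y) :
  mhsm_comp h (mhsm_comp g f) = mhsm_comp (mhsm_comp h g) f.
Proof.
apply: mhsm_hom_eq => /=; [exact: mhs_hom_eq| |];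
  by apply: vecs_hom_eq => k /=; rewrite comp_lfunA.
Qed.

Definition MHSM_category : category :=
  Category mhsm_comp1m mhsm_compm1 mhsm_compA.

End MHS.

(* Main.v *)
Require Import Defs.
From HB Require Import structures.
From mathcomp Require Import all_boot all_order all_algebra.
From mathcomp Require Import boolp reals.
From mathcomp.real_closed Require Import complex.
From mathcomp Require Import zify.
Set Implicit Arguments.
Unset Strict Implicit.
Unset Printing Implicit Defensive.
Import Order.TTheory GRing.Theory Num.Theory.
Local Open Scope ring_scope.

(** Fix a morphism [f] of mixed Hodge structures with modulus. An element [w] of
    the infinitesimal part lifts to the Hodge filtration ([mhsm_F_full]). Two
    lifts differ by an element without infinitesimal component; its first
    component is in the Hodge filtration of the mixed Hodge structure
    ([mhsm_F_hodge]) and determines it ([mhsm_F_add]). So the Hodge filtration is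
    an extension of the infinitesimal part by that of the mixed Hodge structure,
    which is where the following proofs get their elements. Both strictness
    ([mhsm_strict]) and the axioms for the componentwise kernel and cokernel of
    [f] ([mhsm_kernel], [mhsm_cokernel]) reduce to the strictness of morphisms
    of mixed Hodge structures.

    Strictness also makes universal properties componentwise: a componentwise
    injective (surjective) morphism, exact in each component, is a kernel (a
    cokernel), by [mhsm_is_kernel] and [mhsm_is_cokernel], since the filtrations
    of its source (target) are those induced by the other object. A monomorphism
    has zero kernel, hence is injective in each component, hence is a kernel of
    its cokernel; dually for epimorphisms.

    What remains is Deligne's theorem on mixed Hodge structures. Let [W], [F] and
    [G] be the weight filtration, the Hodge filtration and its conjugate. The sum
    over [i >= 0] of the [G (q - i) :&: W (m - i)] is a complement of
    [F p :&: W m] in [W m] when [p + q = m + 1] ([split_F_compl],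
    [conj_compl_capF]), and visibly every map that respects the filtrations
    preserves it. Strictness for [F] follows at once, within each [W m]
    ([filtered_strict_F]). For [W] ([filtered_strict_W]), the components of an
    element along the successive [F p] can be corrected by elements of lower
    weight into Deligne's subspaces [I^{p, q}], on which a map that lowers the
    weight vanishes. These facts also show that the filtrations induced on kernels
    and cokernels are opposed ([opposed_kernel], [opposed_cokernel]).

    The groups and the rational structures have to follow. Tensoring finitely
    generated groups with a field of characteristic 0 is exact ([tens_exact])
    because additive maps to a divisible group extend, and the extension of
    scalars of a subspace commutes with images and preimages under rational maps
    ([complexify_limg], [complexify_preim]), which have pseudo-inverses. *)

(** On goals about integers, the hypotheses on vectors only slow [lia] down. *)
Ltac int_lia :=
  repeat match goal with H : ?T |- _ =>
    lazymatch T with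
    | int => fail
    | nat => fail
    | @eq ?X _ _ => tryif unify X int then fail else clear H
    | is_true (@Order.le _ _ _ _) => fail | is_true (@Order.lt _ _ _ _) => fail
    | _ => clear H
    end
  end; lia.

(** * Opposed filtrations *)

Section LinearMaps.
Variables (K : fieldType) (U V : vectType K) (f : 'Hom(U, V)).

Lemma lfun0 : f 0 = 0. Proof. exact: linear0. Qed.
Lemma lfunN x : f (- x) = - f x. Proof. exact: linearN. Qed.
Lemma lfunD x y : f (x + y) = f x + f y. Proof. exact: linearD. Qed.
Lemma lfunB x y : f (x - y) = f x - f y. Proof. exact: linearB. Qed.

End LinearMaps.

Section Opposed.
Variable K : fieldType.

(** What the complex vector space of a mixed Hodge structure retains of it:
    the weight filtration [W], the Hodge filtration [F] and its conjugate [G].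
    This is Deligne's condition that [F] and [G] induce [n]-opposed filtrations
    on every graded piece [W n / W (n - 1)]. *)
Record opposed (V : vectType K) (W F G : int -> {vspace V}) : Prop := Opposed {
  opp_sum : forall n p q, p + q = n + 1 -> forall x, x \in W n ->
    exists a b c, [/\ a \in F p, a \in W n, b \in G q & b \in W n]
      /\ c \in W (n - 1) /\ x = a + b + c;
  opp_cap : forall n p q, p + q = n + 1 -> forall a b,
    a \in F p -> a \in W n -> b \in G q -> b \in W n -> a - b \in W (n - 1) ->
    a \in W (n - 1) }.

Record opposed_filtrations (V : vectType K) (W F G : int -> {vspace V}) : Prop :=
  OpposedFiltrations {
    filW : forall m n, m <= n -> (W m <= W n)%VS;
    filW0 : exists n, W n = 0%VS;
    filF : forall p q, p <= q -> (F q <= F p)%VS;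
    filG : forall p q, p <= q -> (G q <= G p)%VS;
    fil_opp : opposed W F G }.

Section Complement.
Variables (V : vectType K) (W F G : int -> {vspace V}).
Hypothesis VP : opposed_filtrations W F G.

(** The sum over [i >= 0] of the subspaces [G (q - i) :&: W (m - i)], as a
    predicate because the number of nonzero terms depends on [m]. When
    [p + q = m + 1] it is a complement of [F p :&: W m] in [W m]; unlike an
    arbitrary complement, it is preserved by every filtered map. *)
Inductive conj_compl : int -> int -> V -> Prop :=
| ConjCompl0 q m : conj_compl q m 0
| ConjComplS q m g e : g \in G q -> g \in W m -> conj_compl (q - 1) (m - 1) e ->
    conj_compl q m (g + e).

Lemma conj_complE q m x : conj_compl q m x -> exists g e,
  [/\ g \in G q, g \in W m, conj_compl (q - 1) (m - 1) e & x = g + e].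
Proof.
case=> [{}q {}m|{}q {}m g e gG gW Ce]; last by exists g, e.
by exists 0, 0; rewrite !mem0v addr0; split=> //; constructor.
Qed.

Lemma conj_compl_add q m g x :
  g \in G q -> g \in W m -> conj_compl q m x -> conj_compl q m (g + x).
Proof.
move=> gG gW /conj_complE[g' [e [g'G g'W Ce ->]]]; rewrite addrA.
by constructor; rewrite // memvD.
Qed.

Lemma conj_complD q m x y :
  conj_compl q m x -> conj_compl q m y -> conj_compl q m (x + y).
Proof.
move=> Cx; elim: Cx y => [{}q {}m|{}q {}m g e gG gW _ IH] y Cy.
  by rewrite add0r.
have [g' [e' [g'G g'W Ce' ->]]] := conj_complE Cy.
by rewrite addrACA; constructor; [exact: memvD | exact: memvD | exact: IH].
Qed.

Lemma conj_complN q m x : conj_compl q m x -> conj_compl q m (- x).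
Proof.
elim=> [{}q {}m|{}q {}m g e gG gW _ IH]; first by rewrite oppr0; constructor.
by rewrite opprD; constructor; rewrite ?memvN.
Qed.

Lemma conj_complB q m x y :
  conj_compl q m x -> conj_compl q m y -> conj_compl q m (x - y).
Proof. by move=> Cx /conj_complN; apply: conj_complD. Qed.

Lemma conj_complW q m x : conj_compl q m x -> x \in W m.
Proof.
elim=> [{}q {}m|{}q {}m g e gG gW _ IH]; first exact: mem0v.
by rewrite memvD //; apply: subvP IH; apply: (filW VP); int_lia.
Qed.

Lemma conj_compl_incr q m x :
  conj_compl q m x -> conj_compl (q + 1) (m + 1) x.
Proof.
move=> Cx; rewrite -[x]add0r; constructor; rewrite ?mem0v //.
by rewrite !addrK.
Qed.

Lemma conj_compl_mono q m q' m' x : m <= m' -> q' - q = m' - m ->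
  conj_compl q m x -> conj_compl q' m' x.
Proof.
move=> mm' E; have [j {mm'}Ej] : exists j : nat, m' = m + j%:Z.
  by exists `|m' - m|%N; int_lia.
have {E}-> : q' = q + j%:Z by int_lia.
rewrite {m'}Ej; elim: j => [|j IHj] Cx; first by rewrite !addr0.
by rewrite -addn1 PoszD !addrA; apply/conj_compl_incr/IHj.
Qed.

Lemma conj_compl_drop q m x :
  x \in W (m - 1) -> conj_compl q m x -> conj_compl (q - 1) (m - 1) x.
Proof.
move=> xW /conj_complE[g [e [gG gW Ce E]]]; rewrite E.
apply: conj_compl_add => //; first by apply: subvP gG; apply: (filG VP); int_lia.
have -> : g = x - e by rewrite E addrK.
by rewrite memvB //; apply: conj_complW Ce.
Qed.

Lemma filW_bot m : exists N : nat, forall x, x \in W (m - N%:Z) -> x = 0.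
Proof.
have [n0 Wn0] := filW0 VP; exists `|m - n0|%N => x xW; apply/eqP.
by rewrite -memv0 -Wn0; apply: subvP xW; apply: (filW VP); int_lia.
Qed.

(** Descending induction on the weight: [x] is congruent to its leading term,
    which is in [G q], modulo [W (m - 1)]. As [F p] and [G q] are opposed in
    weight [m], this puts [x] in [W (m - 1)]; then its leading term is there
    too, and can be absorbed into the next one. *)
Lemma conj_compl_capF p q m x : p + q = m + 1 ->
  x \in F p -> conj_compl q m x -> x = 0.
Proof.
move=> pq xF Cx; have [N] := filW_bot m; apply.
elim: N q m pq Cx => [|N IHN] q m pq Cx; first by rewrite subr0; apply: conj_complW Cx.
have xW1 : x \in W (m - 1).
  have [g [e [gG gW Ce E]]] := conj_complE Cx.
  apply: (opp_cap (fil_opp VP) pq xF _ gG gW); first exact: conj_complW Cx.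
  by rewrite E addrC addKr; apply: conj_complW Ce.
have -> : m - N.+1%:Z = (m - 1) - N%:Z by int_lia.
apply: (IHN (q - 1)); first int_lia.
exact: conj_compl_drop.
Qed.

(** The graded piece of weight [m] is the sum of the subspaces induced by [F p]
    and [G q]; the remainder, in [W (m - 1)], is decomposed in the same way with
    [q - 1] in place of [q], until the weight filtration vanishes. *)
Lemma split_F_compl p q m x : p + q = m + 1 -> x \in W m ->
  exists a b, [/\ a \in F p, a \in W m, conj_compl q m b & x = a + b].
Proof.
have [N Wbot] := filW_bot m.
elim: N q m x Wbot => [|N IHN] q m x Wbot pq xW.
  exists 0, 0; rewrite !mem0v addr0; split=> //; first by constructor.
  by apply: Wbot; rewrite subr0.
have [a [b [c [[aF aW bG bW] [cW ->]]]]] := opp_sum (fil_opp VP) pq xW.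
have [||| a' [b' [a'F a'W Cb' ->]]] := IHN (q - 1) (m - 1) c => //; try int_lia.
  by move=> y yW; apply: Wbot; have -> : m - N.+1%:Z = m - 1 - N%:Z by int_lia.
exists (a + a'), (b + b'); split; first exact: memvD.
- by rewrite memvD //; apply: subvP a'W; apply: (filW VP); int_lia.
- by constructor.
- by rewrite addrACA.
Qed.

Lemma split_F_unique p q m a b a' b' : p + q = m + 1 ->
  a \in F p -> a' \in F p -> conj_compl q m b -> conj_compl q m b' ->
  a + b = a' + b' -> a = a'.
Proof.
move=> pq aF a'F Cb Cb' E; apply/eqP; rewrite -subr_eq0; apply/eqP.
have Ed : a - a' = b' - b.
  by apply/eqP; rewrite subr_eq -addrA [_ + a']addrC addrA eq_sym subr_eq E addrC.
apply: (conj_compl_capF pq); first exact: memvB.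
by rewrite Ed; apply: conj_complB.
Qed.

End Complement.

Section Strict.
Variables (V V' : vectType K) (W F G : int -> {vspace V}).
Variables (W' F' G' : int -> {vspace V'}) (f : 'Hom(V, V')).
Hypothesis VP : opposed_filtrations W F G.
Hypothesis VP' : opposed_filtrations W' F' G'.
Hypothesis fW : forall n x, x \in W n -> f x \in W' n.
Hypothesis fF : forall n x, x \in F n -> f x \in F' n.
Hypothesis fG : forall n x, x \in G n -> f x \in G' n.

Lemma conj_compl_morph q m x :
  conj_compl W G q m x -> conj_compl W' G' q m (f x).
Proof.
elim=> [{}q {}m|{}q {}m g e gG gW _ IH]; first by rewrite lfun0; constructor.
by rewrite lfunD; constructor; [apply: fG | apply: fW |].
Qed.

(** As [f] maps complements to complements, it maps the component of [x] along
    [F p] to the component of [f x] along [F' p], which is [f x] itself. *)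
Lemma filtered_strict_F m p x : x \in W m -> f x \in F' p ->
  exists2 a, a \in F p /\ a \in W m & f a = f x.
Proof.
move=> xW fxF; have pq : p + (m + 1 - p) = m + 1 by int_lia.
have [a [b [aF aW Cb E]]] := split_F_compl VP pq xW.
exists a => //; apply: (split_F_unique VP' pq (b := f b) (b' := 0)).
- exact: fF.
- exact: fxF.
- exact: (conj_compl_morph Cb).
- by constructor.
- by rewrite -lfunD -E addr0.
Qed.

(** Let [b] be the component of [x] in the complement of [F (p + 1)]. Subtracting
    an element of [W (m - 1)] from [b] makes it an element of Deligne's subspace
    [I^{p, m - p}], which meets [W (m - 1)] trivially in any such space. Its
    image under [f], which is in [W' (m - 1)], is therefore 0. *)
Lemma filtered_strict_W_step m p x :
    x \in W m -> x \in F p -> f x \in W' (m - 1) ->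
  exists a y, [/\ a \in W (m - 1), y \in W m, y \in F (p + 1)
    & f x = f a + f y].
Proof.
move=> xW xF fxW; have pq : (p + 1) + (m - p) = m + 1 by int_lia.
have [y [b [yF yW Cb E]]] := split_F_compl VP pq xW.
have [g [e [gG gW Ce Eb]]] := conj_complE Cb.
have pq' : p + (m - p) = (m - 1) + 1 by int_lia.
have [a [e' [aF aW Ce' Ee]]] := split_F_compl VP pq' (conj_complW VP Ce).
exists a, y; split=> //.
have Ez : b - a = g + e' by rewrite Eb Ee addrCA addrC addrK.
suff fz : f (b - a) = 0.
  move: fz; rewrite lfunB => /eqP; rewrite subr_eq0 => /eqP <-.
  by rewrite E lfunD addrC.
have zF : f (b - a) \in F' p.
  apply: fF; rewrite memvB //; have -> : b = x - y by rewrite E addrC addKr.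
  by rewrite memvB //; apply: subvP yF; apply: (filF VP); int_lia.
have fbW : f b \in W' (m - 1).
  have pq1 : (p + 1) + (m - p - 1) = (m - 1) + 1 by int_lia.
  have [y' [b' [y'F y'W Cb' E']]] := split_F_compl VP' pq1 fxW.
  have Ey : f y = y'.
    apply: (split_F_unique VP' pq (b := f b) (b' := b')) => //.
    - exact: fF.
    - exact: (conj_compl_morph Cb).
    - by apply: conj_compl_mono Cb'; int_lia.
    - by rewrite -lfunD -E.
  move: E'; rewrite E lfunD Ey => /addrI ->. exact: (conj_complW VP' Cb').
have faW : f a \in W' (m - 1) by apply: fW.
have fzW : f (b - a) \in W' (m - 1) by rewrite lfunB memvB.
have Ce'' := conj_compl_morph Ce'.
apply: (conj_compl_capF VP' pq' zF); rewrite Ez lfunD.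
apply: conj_compl_add; [exact: fG | | exact: Ce''].
have -> : f g = f (b - a) - f e' by rewrite Ez lfunD addrK.
by rewrite memvB //; apply: (conj_complW VP' Ce'').
Qed.

(** [F p] is everything for small [p], so [x] may be assumed to lie in it; as
    [p] grows to where [F p = 0], only the terms from [W (m - 1)] remain. *)
Lemma filtered_strict_W_1 m x : (exists p, F p = fullv) ->
  (exists p, F p = 0%VS) -> x \in W m -> f x \in W' (m - 1) ->
  exists2 a, a \in W (m - 1) & f a = f x.
Proof.
move=> [p0 Fp0] [p1 Fp1] xW fxW.
suff : forall j : nat, exists a y,
    [/\ a \in W (m - 1), y \in W m, y \in F (p0 + j%:Z) & f x = f a + f y].
  move=> /(_ `|p1 - p0|%N)[a [y [aW _ yF Ef]]]; exists a => //.
  suff y0 : y = 0 by rewrite Ef y0 lfun0 addr0.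
  by apply/eqP; rewrite -memv0 -Fp1; apply: subvP yF; apply: (filF VP); int_lia.
elim=> [|j [a [y [aW yW yF Ef]]]].
  by exists 0, x; rewrite mem0v lfun0 add0r addr0 Fp0 memvf.
have fyW : f y \in W' (m - 1).
  have -> : f y = f x - f a by rewrite Ef addrC addKr.
  by rewrite memvB // fW.
have [a' [y' [a'W y'W y'F Ef']]] := filtered_strict_W_step yW yF fyW.
exists (a + a'), y'; split=> //; first exact: memvD.
  by rewrite -addn1 PoszD addrA.
by rewrite Ef Ef' lfunD addrA.
Qed.

Lemma filtered_strict_W m n x : (exists p, F p = fullv) ->
  (exists p, F p = 0%VS) -> x \in W m -> f x \in W' n ->
  exists2 a, a \in W n & f a = f x.
Proof.
move=> FT F0 xW fxW; have [mn|/ltW nm] := lerP m n.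
  by exists x => //; apply: subvP xW; apply: (filW VP).
have [j Ej] : exists j : nat, m = n + j%:Z by exists `|m - n|%N; int_lia.
elim: j m x Ej {nm} xW fxW => [|j IHj] m x Em xW fxW.
  by exists x; rewrite // -[n]addr0 -Em.
have [|a aW fa] := filtered_strict_W_1 FT F0 xW.
  by apply: subvP fxW; apply: (filW VP'); int_lia.
have Em1 : m - 1 = n + j%:Z by int_lia.
have [|b bW fb] := IHj _ a Em1 aW; first by rewrite fa.
by exists b; rewrite // fb.
Qed.

End Strict.

(** * Opposed filtrations on kernels, cokernels and direct sums *)

Lemma opposed_sym (V : vectType K) (W F G : int -> {vspace V}) :
  opposed W F G -> opposed W G F.
Proof.
case=> sumO capO; split=> n p q pq.
  move=> x xW; have qp : q + p = n + 1 by rewrite addrC.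
  have [a [b [c [[aF aW bG bW] [cW ->]]]]] := sumO n q p qp x xW.
  by exists b, a, c; rewrite [b + a]addrC.
move=> a b aG aW bF bW abW; have qp : q + p = n + 1 by rewrite addrC.
have bW1 : b \in W (n - 1).
  by apply: (capO n q p qp b a) => //; rewrite -opprB memvN.
by rewrite -(subrK b a) memvD.
Qed.

Lemma opposed_filtrations_sym (V : vectType K) (W F G : int -> {vspace V}) :
  opposed_filtrations W F G -> opposed_filtrations W G F.
Proof. by case=> *; split=> //; apply: opposed_sym. Qed.

Section KernelCokernel.
Variables (V V' : vectType K) (W F G : int -> {vspace V}).
Variables (W' F' G' : int -> {vspace V'}) (f : 'Hom(V, V')).
Hypothesis VP : opposed_filtrations W F G.
Hypothesis VP' : opposed_filtrations W' F' G'.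
Hypothesis fW : forall n x, x \in W n -> f x \in W' n.
Hypothesis fF : forall n x, x \in F n -> f x \in F' n.
Hypothesis fG : forall n x, x \in G n -> f x \in G' n.

(** The components of an element of the kernel along [F p] and its functorial
    complement are in the kernel. The leading term of the second one need not
    be, but strictness corrects it by an element of [W (n - 1)]. *)
Lemma opposed_kernel (U : vectType K) (i : 'Hom(U, V)) :
  injective i -> limg i = lker f ->
  opposed (fun n => i @^-1: W n)%VS (fun n => i @^-1: F n)%VS
          (fun n => i @^-1: G n)%VS.
Proof.
move=> iI iker.
have lift x : f x = 0 -> exists u, i u = x.
  by move/eqP; rewrite -memv_ker -iker => /memv_imgP[u _ ->]; exists u.
have fi u : f (i u) = 0.
  by apply/eqP; rewrite -memv_ker -iker memv_img ?memvf.
split=> n p q pq.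
  move=> u; rewrite -memv_preim => uW.
  have [a [b [aF aW Cb E]]] := split_F_compl VP pq uW.
  have fa0 : f a = 0.
    apply: (split_F_unique VP' pq (a' := 0) (b := f b) (b' := 0)).
    - exact: fF.
    - exact: mem0v.
    - exact: (conj_compl_morph fW fG).
    - by constructor.
    - by rewrite -lfunD -E fi addr0.
  have [g [e [gG gW Ce Eb]]] := conj_complE Cb.
  have feG : f e \in G' q.
    have -> : f e = - f g; last by rewrite memvN fG.
    apply/eqP; rewrite -addr_eq0 -lfunD addrC -Eb.
    by rewrite -[b](addKr a) -E lfunD lfunN fa0 fi oppr0 addr0.
  have [e0 [e0G e0W] fe0] := filtered_strict_F (opposed_filtrations_sym VP)
    (opposed_filtrations_sym VP') fW fG fF (conj_complW VP Ce) feG.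
  have [a' Ea'] := lift _ fa0.
  have [|b' Eb'] := lift (g + e0).
    have := fi u; rewrite E Eb !lfunD fa0 add0r fe0 //.
  have [c' Ec'] : exists c', i c' = e - e0.
    by apply: lift; rewrite lfunB fe0 subrr.
  exists a', b', c'; rewrite -!memv_preim Ea' Eb' Ec'; split; first split=> //.
  - exact: memvD.
  - by rewrite memvD //; apply: subvP e0W; apply: (filW VP); int_lia.
  split; first by rewrite memvB //; apply: (conj_complW VP Ce).
  by apply: iI; rewrite !lfunD Ea' Eb' Ec' E Eb -!addrA [e0 + _]addrC subrK.
move=> a b; rewrite -!memv_preim lfunB; exact: (opp_cap (fil_opp VP)).
Qed.

(** The images of [F' p] and of [W' n] in the cokernel of [f] meet in the image
    of their intersection: the complements of [F p] in the various [W n] are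
    nested, so the component of [w] along [F' p] is both in [W' n] and, modulo
    the image of [f], the component of [a], which is [a] itself. *)
Lemma image_F_capW p n a w x : (exists m, W m = fullv) ->
    a \in F' p -> w \in W' n -> a - w = f x ->
  exists2 a', a' \in F' p /\ a' \in W' n & exists y, a - a' = f y.
Proof.
move=> [m0 Wm0] aF wW E.
pose m := Num.max m0 n.
have xW : x \in W m.
  have: x \in W m0 by rewrite Wm0 memvf.
  by apply: subvP; apply: (filW VP); rewrite /m le_max lexx.
have pqn : p + (n + 1 - p) = n + 1 by int_lia.
have pqm : p + (m + 1 - p) = m + 1 by int_lia.
have [wF [wC [wFF wFW CwC Ew]]] := split_F_compl VP' pqn wW.
have [xF [xC [xFF _ CxC Ex]]] := split_F_compl VP pqm xW.
exists wF => //; exists xF.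
apply/eqP; rewrite subr_eq addrC; apply/eqP.
apply: (split_F_unique VP' pqm (b := 0) (b' := wC + f xC)) => //.
- by rewrite memvD // fF.
- by constructor.
- apply: conj_complD; last exact: (conj_compl_morph fW fG).
  by apply: conj_compl_mono CwC; rewrite /m; int_lia.
- by rewrite addr0 addrACA -Ew -lfunD -Ex -E addrC subrK.
Qed.

End KernelCokernel.

Section Cokernel.
Variables (V V' : vectType K) (W F G : int -> {vspace V}).
Variables (W' F' G' : int -> {vspace V'}) (f : 'Hom(V, V')).
Hypothesis VP : opposed_filtrations W F G.
Hypothesis VP' : opposed_filtrations W' F' G'.
Hypothesis fW : forall n x, x \in W n -> f x \in W' n.
Hypothesis fF : forall n x, x \in F n -> f x \in F' n.
Hypothesis fG : forall n x, x \in G n -> f x \in G' n.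
Hypothesis WT : exists m, W m = fullv.
Hypothesis FT : exists p, F p = fullv.
Hypothesis F0 : exists p, F p = 0%VS.

(** Sums pass to quotients; for intersections, representatives in [F' p] and in
    [G' q] of the same class differ by an element of [W' (n - 1)] modulo some [f z],
    where strictness lets [z] be taken in [W n]. The components of [z] in [F p]
    and in [G q] correct the representatives. *)
Lemma opposed_cokernel (Q : vectType K) (r : 'Hom(V', Q)) :
  lker r = limg f ->
  opposed (fun n => r @: W' n)%VS (fun n => r @: F' n)%VS
          (fun n => r @: G' n)%VS.
Proof.
move=> rker.
have rf x : r (f x) = 0.
  by apply/eqP; rewrite -memv_ker rker memv_img ?memvf.
have lift a b : r a = r b -> exists x, a - b = f x.
  move=> E; suff: a - b \in lker r.
    by rewrite rker => /memv_imgP[x _ ->]; exists x.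
  by rewrite memv_ker lfunB E subrr.
have VPs := opposed_filtrations_sym VP; have VPs' := opposed_filtrations_sym VP'.
split=> n p q pq.
  move=> _ /memv_imgP[x xW ->].
  have [a [b [c [[aF aW bG bW] [cW ->]]]]] := opp_sum (fil_opp VP') pq xW.
  exists (r a), (r b), (r c); rewrite !memv_img // !lfunD; split=> //.
move=> z1 z2 /memv_imgP[a aF ->{z1}] /memv_imgP[w wW Eaw].
move=> /memv_imgP[b bG ->{z2}] /memv_imgP[v vW Ebv] /memv_imgP[c cW].
have [x Ex] := lift _ _ Eaw; have [y Ey] := lift _ _ Ebv.
have [a' [a'F a'W] [x' Ex']] := image_F_capW VP VP' fW fF fG WT aF wW Ex.
have [b' [b'G b'W] [y' Ey']] := image_F_capW VPs VPs' fW fG fF WT bG vW Ey.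
have Era : r a = r a'.
  by apply/eqP; rewrite -subr_eq0 -lfunB Ex' rf.
have Erb : r b = r b'.
  by apply/eqP; rewrite -subr_eq0 -lfunB Ey' rf.
rewrite Era Erb -lfunB => /lift[z Ez].
have abW : a' - b' \in W' n by rewrite memvB.
have cWn : c \in W' n by apply: subvP cW; apply: (filW VP'); int_lia.
have [m0 Wm0] := WT.
have [||z' z'W fz'] := filtered_strict_W VP VP' fW fF fG (m := m0) (n := n)
    (x := z) FT F0; rewrite ?Wm0 ?memvf -?Ez ?memvB //.
have [zF [zC [zFF zFW CzC Ez']]] := split_F_compl VP pq z'W.
have [g [e [gG gW Ce EzC]]] := conj_complE CzC.
have -> : r a' = r (a' - f zF) by rewrite lfunB rf subr0.
apply: memv_img.
apply: (opp_cap (fil_opp VP') pq (b := b' + f g)).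
- by rewrite memvB // fF.
- by rewrite memvB // fW.
- by rewrite memvD // fG.
- by rewrite memvD // fW.
have -> : a' - f zF - (b' + f g) = c + f e.
  have E : a' - b' = (f zF + f g) + (c + f e).
    rewrite addrCA -addrA -!lfunD -EzC -Ez' fz' -Ez.
    by rewrite addrC subrK.
  by rewrite opprD addrACA -opprD E addrC addKr.
by rewrite memvD // fW //; apply: (conj_complW VP Ce).
Qed.

End Cokernel.

Section DirectSum.
Variables (V1 V2 V : vectType K).
Variables (i1 : 'Hom(V1, V)) (i2 : 'Hom(V2, V)).
Variables (p1 : 'Hom(V, V1)) (p2 : 'Hom(V, V2)).
Hypothesis pi1 : forall x, p1 (i1 x) = x.
Hypothesis pi2 : forall x, p2 (i2 x) = x.
Hypothesis ip : forall x, i1 (p1 x) + i2 (p2 x) = x.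

Lemma biprod_cross1 x : p1 (i2 x) = 0.
Proof.
have /eqP := ip (i2 x); rewrite pi2 -subr_eq0 addrK => /eqP/(congr1 p1).
by rewrite pi1 lfun0.
Qed.

Lemma biprod_cross2 x : p2 (i1 x) = 0.
Proof.
have /eqP := ip (i1 x); rewrite pi1 addrC -subr_eq0 addrK => /eqP/(congr1 p2).
by rewrite pi2 lfun0.
Qed.

Lemma memv_biprod (A1 : {vspace V1}) (A2 : {vspace V2}) x :
  (x \in (i1 @: A1 + i2 @: A2)%VS) = (p1 x \in A1) && (p2 x \in A2).
Proof.
apply/idP/andP=> [/memv_addP[_ /memv_imgP[a aA ->] [_ /memv_imgP[b bA ->] ->]]|].
  by rewrite !lfunD pi1 pi2 biprod_cross1 biprod_cross2 addr0 add0r.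
by case=> xA1 xA2; rewrite -[x]ip memv_add ?memv_img.
Qed.

Lemma opposed_biprod (W1 F1 G1 : int -> {vspace V1})
    (W2 F2 G2 : int -> {vspace V2}) :
  opposed W1 F1 G1 -> opposed W2 F2 G2 ->
  opposed (fun n => i1 @: W1 n + i2 @: W2 n)%VS
    (fun n => i1 @: F1 n + i2 @: F2 n)%VS (fun n => i1 @: G1 n + i2 @: G2 n)%VS.
Proof.
move=> [sum1 cap1] [sum2 cap2]; split=> n p q pq.
  move=> x; rewrite memv_biprod => /andP[x1 x2].
  have [a1 [b1 [c1 [[? ? ? ?] [? E1]]]]] := sum1 n p q pq _ x1.
  have [a2 [b2 [c2 [[? ? ? ?] [? E2]]]]] := sum2 n p q pq _ x2.
  exists (i1 a1 + i2 a2), (i1 b1 + i2 b2), (i1 c1 + i2 c2).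
  split; first by split; apply: memv_add; apply: memv_img.
  split; first by apply: memv_add; apply: memv_img.
  rewrite -[x]ip E1 E2 !lfunD addrACA; congr (_ + _); exact: addrACA.
move=> a b; rewrite !memv_biprod !lfunB.
move=> /andP[? ?] /andP[? ?] /andP[? ?] /andP[? ?] /andP[? ?].
by apply/andP; split; [apply: (cap1 n p q pq _ (p1 b)) | apply: (cap2 n p q pq _ (p2 b))].
Qed.

End DirectSum.
End Opposed.

(** * Finitely generated abelian groups *)

Section FinGen.
Variable M : zmodType.

(** Recursion on the generators allows them to be eliminated one at a time. *)
Fixpoint zspan (s : seq M) (x : M) : Prop :=
  if s is m :: s' then exists j : int, zspan s' (x - m *~ j) else x = 0.

Lemma zspanP s x : zspan s x <->
  exists c : 'I_(size s) -> int, x = \sum_(i < size s) s`_i *~ c i.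
Proof.
elim: s x => [|m s IHs] x /=.
  split=> [->|[c ->]]; last by rewrite big_ord0.
  by exists (fun=> 0); rewrite big_ord0.
split=> [[j /IHs[c E]]|[c ->]].
  exists (fun i => oapp c j (unlift ord0 i)).
  rewrite big_ord_recl unlift_none /= -[LHS](subrK (m *~ j)) addrC E.
  by congr (_ + _); apply: eq_bigr => i _; rewrite liftK.
exists (c ord0); apply/IHs; exists (fun i => c (lift ord0 i)).
by rewrite big_ord_recl /= addrC addKr.
Qed.

Lemma zspan0 s : zspan s 0.
Proof. by elim: s => //= m s IHs; exists 0; rewrite mulr0z subr0. Qed.

Lemma zspanB s x y : zspan s x -> zspan s y -> zspan s (x - y).
Proof.
move=> /zspanP[c ->] /zspanP[d ->]; apply/zspanP; exists (fun i => c i - d i).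
by rewrite -sumrB; apply: eq_bigr => i _; rewrite mulrzBr.
Qed.

Lemma zspanMz s x j : zspan s x -> zspan s (x *~ j).
Proof.
move=> /zspanP[c ->]; apply/zspanP; exists (fun i => c i * j).
by rewrite mulrz_suml; apply: eq_bigr => i _; rewrite mulrzA.
Qed.

Definition subgroup (P : M -> Prop) : Prop :=
  P 0 /\ forall x y, P x -> P y -> P (x - y).

Lemma subgroupN P x : subgroup P -> P x -> P (- x).
Proof. by move=> [P0 PB] Px; rewrite -sub0r; apply: PB. Qed.

Lemma subgroupD P x y : subgroup P -> P x -> P y -> P (x + y).
Proof.
by move=> gP Px Py; rewrite -[y]opprK; apply: (proj2 gP) => //; apply: subgroupN.
Qed.

Lemma subgroupMz P x j : subgroup P -> P x -> P (x *~ j).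
Proof.
move=> gP Px; have Pn n : P (x *+ n).
  elim: n => [|n IHn]; first by rewrite mulr0n; apply: (proj1 gP).
  by rewrite mulrS; apply: subgroupD.
case: j => n; first exact: Pn.
by rewrite NegzE mulrNz; apply: subgroupN => //; apply: Pn.
Qed.

(** The coefficients on the first generator of the elements of a subgroup form
    a subgroup of the integers. If [p0] realizes a generator [d] of it, then
    [p0] and the elements with zero first coefficient generate the subgroup. *)
Lemma subgroup_zspan s (P : M -> Prop) : subgroup P ->
    (forall x, P x -> zspan s x) ->
  exists2 t, (forall x, x \in t -> P x) & forall x, P x -> zspan t x.
Proof.
elim: s P => [|m s IHs] P gP Ps; first by exists [::].
pose J (j : int) := exists2 x, P x & zspan s (x - m *~ j).
have JP x : P x -> exists2 j, J j & zspan s (x - m *~ j).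
  by move=> Px; have [j xj] := Ps x Px; exists j => //; exists x.
pose P' x := P x /\ zspan s x.
have gP' : subgroup P'.
  split; first by split; [apply: (proj1 gP) | apply: zspan0].
  by move=> x y [? ?] [? ?]; split; [apply: (proj2 gP) | apply: zspanB].
have [t tP' P't] := IHs P' gP' (fun x => @proj2 _ _).
have [[d [d0 [p0 Pp0 sp0]]]|J0] := pselect (exists d : int, d != 0 /\ J d).
  have posJ : exists n : nat, `[< (0 < n)%N /\ J n%:Z >].
    exists `|d|%N; apply/asboolP; rewrite absz_gt0; split=> //.
    have [d_ge0|d_lt0] := lerP 0 d; first by exists p0; rewrite ?gez0_abs.
    exists (- p0); first exact: subgroupN.
    rewrite ltz0_abs // mulrNz -opprD -sub0r; apply: zspanB => //.
    exact: zspan0.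
  case: (ex_minnP posJ) => e /asboolP[e_gt0 [x0 Px0 sx0]] emin.
  have divJ j : J j -> (j %% e%:Z)%Z = 0.
    move=> [x Px sx]; apply/eqP/negPn/negP => r0.
    have e0 : e%:Z != 0 by rewrite -lt0n in e_gt0 *; lia.
    have r_ge0 := modz_ge0 j e0; have := ltz_pmod j (e_gt0 : 0 < e%:Z).
    suff: (e <= `|(j %% e)%Z|)%N by lia.
    apply: emin; apply/asboolP; split; first by rewrite absz_gt0.
    rewrite gez0_abs //; exists (x - x0 *~ (j %/ e)%Z).
      by apply: (proj2 gP) => //; apply: subgroupMz.
    have -> : (j %% e)%Z = j - e%:Z * (j %/ e)%Z.
      by rewrite {2}(divz_eq j e) mulrC addrC addKr.
    have -> : x - x0 *~ (j %/ e)%Z - m *~ (j - e%:Z * (j %/ e)%Z) =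
              (x - m *~ j) - (x0 - m *~ e) *~ (j %/ e)%Z.
      rewrite mulrzBr mulrzBl mulrzA !opprB addrACA [RHS]addrACA.
      by congr (_ + _); apply: addrC.
    by apply: zspanB => //; apply: zspanMz.
  exists (x0 :: t) => [x|x Px /=]; first by rewrite inE => /orP[/eqP->|/tP'[]].
  have [j Jj sj] := JP x Px; exists (j %/ e)%Z.
  have jE : j = e%:Z * (j %/ e)%Z.
    by rewrite {1}(divz_eq j e) divJ // addr0 mulrC.
  apply: P't; split; first by apply: (proj2 gP) => //; apply: subgroupMz.
  have -> : x - x0 *~ (j %/ e)%Z =
            (x - m *~ j) - (x0 - m *~ e) *~ (j %/ e)%Z.
    by rewrite mulrzBl -mulrzA -jE opprB addrA subrK.
  by apply: zspanB => //; apply: zspanMz.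
exists t => [x /tP'[]//|x Px]; apply: P't; split=> //.
have [j Jj sj] := JP x Px.
suff j0 : j = 0 by rewrite j0 mulr0z subr0 in sj.
by apply/eqP/negPn/negP => j0; apply: J0; exists j.
Qed.

End FinGen.

Lemma zspan_map (M N : zmodType) (f : {additive M -> N}) s x :
  zspan s x -> zspan (map f s) (f x).
Proof.
elim: s x => [|m s IHs] x /=; first by move->; rewrite raddf0.
by case=> j /IHs; rewrite raddfB raddfMz; exists j.
Qed.

Lemma fg_zspan (M : fgZmodType) : exists s : seq M, forall x, zspan s x.
Proof. by have [s sM] := @fin_gen M; exists s => x; apply/zspanP. Qed.

Section GroupKernel.
Variables (M N : fgZmodType) (f : {additive M -> N}).

Definition ker_pred : {pred M} := fun x => f x == 0.

Fact ker_pred_closed : zmod_closed ker_pred.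
Proof.
split=> [|x y]; rewrite !unfold_in /ker_pred ?raddf0 // raddfB.
by move=> /eqP-> /eqP->; rewrite subrr.
Qed.
HB.instance Definition _ := GRing.isZmodClosed.Build M ker_pred ker_pred_closed.

Definition ker_type := {x : M | x \in ker_pred}.
HB.instance Definition _ := [isSub of ker_type for sval].
HB.instance Definition _ := [Choice of ker_type by <:].
HB.instance Definition _ := [SubChoice_isSubZmodule of ker_type by <:].

Fact ker_fin_gen : exists s : seq ker_type, forall x : ker_type,
  exists c : 'I_(size s) -> int, x = \sum_(i < size s) s`_i *~ c i.
Proof.
have [s sM] := fg_zspan M.
have gP : subgroup (fun x => x \in ker_pred).
  by split=> [|x y xP yP]; rewrite ?rpred0 ?rpredB.
have [t tP Pt] := subgroup_zspan gP (fun x _ => sM x).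
have [u Eu] : exists u : seq ker_type, t = map val u.
  exists (pmap insub t); elim: t tP {Pt} => //= y t IHt tP.
  have yP : y \in ker_pred by apply: tP; rewrite mem_head.
  by rewrite insubT /= -IHt // => z zt; apply: tP; rewrite inE zt orbT.
exists u; move=> x; apply/zspanP; have: zspan (map val u) (val x).
  by rewrite -Eu; apply/Pt/valP.
elim: u (x) {Eu} => [|m u IHu] y /=; first by move=> y0; apply: val_inj.
by case=> j uy; exists j; apply: IHu; rewrite raddfB raddfMz.
Qed.
HB.instance Definition _ := Zmodule_isFinGen.Build ker_type ker_fin_gen.

Definition ker_incl (x : ker_type) : M := val x.
HB.instance Definition _ := GRing.isZmodMorphism.Build ker_type M ker_incl
  (fun x y : ker_type => erefl : ker_incl (x - y) = ker_incl x - ker_incl y).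

Lemma ker_incl_inj : injective ker_incl. Proof. exact: val_inj. Qed.

Lemma ker_inclP x : f x = 0 <-> exists y, ker_incl y = x.
Proof.
split=> [fx0|[y <-]]; last by apply/eqP; apply: (valP y).
have xP : x \in ker_pred by rewrite unfold_in /ker_pred fx0.
by exists (Sub x xP); rewrite /ker_incl SubK.
Qed.

End GroupKernel.

Section GroupCokernel.
Variables (M N : fgZmodType) (f : {additive M -> N}).

Definition im_pred : {pred N} := fun y => `[< exists x, f x = y >].

Fact im_pred_closed : zmod_closed im_pred.
Proof.
split=> [|_ _ /asboolP[x <-] /asboolP[y <-]]; apply/asboolP.
  by exists 0; rewrite raddf0.
by exists (x - y); rewrite raddfB.
Qed.
HB.instance Definition _ := GRing.isZmodClosed.Build N im_pred im_pred_closed.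

Definition coker_type := Quotient.quot im_pred.
HB.instance Definition _ := GRing.Zmodule.on coker_type.

Definition coker_proj (y : N) : coker_type := \pi_coker_type%qT y.

Fact coker_projB : zmod_morphism coker_proj.
Proof. exact: (@raddfB _ _ \pi_(Quotient.quot im_pred)%qT). Qed.
HB.instance Definition _ :=
  GRing.isZmodMorphism.Build N coker_type coker_proj coker_projB.

Lemma coker_projP y : coker_proj y = 0 <-> exists x, f x = y.
Proof.
rewrite -(raddf0 coker_proj); split.
  by move/eqP; rewrite /coker_proj -Quotient.idealrBE subr0 => /asboolP.
move=> fy; apply/eqP; rewrite /coker_proj -Quotient.idealrBE subr0.
exact/asboolP.
Qed.

Lemma coker_proj_surj z : exists y, coker_proj y = z.
Proof. by exists (repr z); rewrite /coker_proj reprK. Qed.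

Fact coker_fin_gen : exists s : seq coker_type, forall x : coker_type,
  exists c : 'I_(size s) -> int, x = \sum_(i < size s) s`_i *~ c i.
Proof.
have [s sN] := fg_zspan N; exists (map coker_proj s); move=> x.
by apply/zspanP; have [y <-] := coker_proj_surj x; apply: zspan_map.
Qed.
HB.instance Definition _ := Zmodule_isFinGen.Build coker_type coker_fin_gen.

End GroupCokernel.

Lemma zspan_cat (M : zmodType) (s t : seq M) x y :
  zspan s x -> zspan t y -> zspan (s ++ t) (x + y).
Proof.
elim: s x => [|m s IHs] x /=; first by move=> ->; rewrite add0r.
by case=> j sx ty; exists j; rewrite addrAC; apply: IHs.
Qed.

Section ProdFinGen.
Variables M N : fgZmodType.

Definition prod_inl (x : M) : M * N := (x, 0).
Definition prod_inr (y : N) : M * N := (0, y).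

Fact prod_inlB : zmod_morphism prod_inl.
Proof. by move=> x y; congr pair; rewrite subr0. Qed.
Fact prod_inrB : zmod_morphism prod_inr.
Proof. by move=> x y; congr pair; rewrite subr0. Qed.
HB.instance Definition _ := GRing.isZmodMorphism.Build M (M * N)%type prod_inl prod_inlB.
HB.instance Definition _ := GRing.isZmodMorphism.Build N (M * N)%type prod_inr prod_inrB.

Lemma prod_inD x : prod_inl x.1 + prod_inr x.2 = x.
Proof. by case: x => x y; congr pair; rewrite ?addr0 ?add0r. Qed.

Fact prod_fin_gen : exists s : seq (M * N), forall x : M * N,
  exists c : 'I_(size s) -> int, x = \sum_(i < size s) s`_i *~ c i.
Proof.
have [s sM] := fg_zspan M; have [t tN] := fg_zspan N.
exists (map prod_inl s ++ map prod_inr t); move=> x; apply/zspanP.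
by rewrite -[x]prod_inD; apply: zspan_cat; apply: zspan_map.
Qed.
HB.instance Definition _ := Zmodule_isFinGen.Build (M * N)%type prod_fin_gen.

End ProdFinGen.

Definition zero_group := 'rV[int]_0.
HB.instance Definition _ := GRing.Zmodule.on zero_group.

Lemma zero_groupE (x : zero_group) : x = 0. Proof. exact: thinmx0. Qed.

Fact zero_fin_gen : exists s : seq zero_group, forall x : zero_group,
  exists c : 'I_(size s) -> int, x = \sum_(i < size s) s`_i *~ c i.
Proof. by exists [::]; move=> x; exists (fun=> 0); rewrite [x]zero_groupE big_ord0. Qed.
HB.instance Definition _ := Zmodule_isFinGen.Build zero_group zero_fin_gen.

(** * Exactness of the tensor product with a field of characteristic 0 *)

Section Extension.
Variables (N : zmodType) (K : numFieldType).

(** The graph of an additive map from a subgroup of [N] to [K]. *)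
Definition partial_hom (G : N -> K -> Prop) : Prop :=
  [/\ G 0 0, forall x y a b, G x a -> G y b -> G (x - y) (a - b)
    & forall a, G 0 a -> a = 0].

Lemma partial_homN G x a : partial_hom G -> G x a -> G (- x) (- a).
Proof. by case=> G0 GB _ Gx; rewrite -sub0r -[- a]sub0r; apply: GB. Qed.

Lemma partial_homMz G x a j :
  partial_hom G -> G x a -> G (x *~ j) (j%:~R * a).
Proof.
move=> gG Gx; have [G0 GB _] := gG.
have Gn n : G (x *+ n) (n%:R * a).
  elim: n => [|n IHn]; first by rewrite mulr0n mul0r.
  have := GB _ _ _ _ IHn (partial_homN gG Gx); rewrite !opprK.
  by rewrite mulrSr -natr1 mulrDl mul1r.
case: j => n; first exact: Gn.
by rewrite NegzE mulrNz rmorphN mulNr; apply: partial_homN => //; apply: Gn.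
Qed.

Lemma partial_hom_fun G x a b : partial_hom G -> G x a -> G x b -> a = b.
Proof.
case=> _ GB Gf Ga Gb; apply/eqP; rewrite -subr_eq0; apply/eqP/Gf.
by rewrite -[0](subrr x); apply: GB.
Qed.

(** The value at [n] is forced when a nonzero multiple of [n] is in the domain,
    and can be divided by that multiple; otherwise any value will do. *)
Lemma partial_hom_extend1 G n : partial_hom G -> exists G',
  [/\ partial_hom G', forall x a, G x a -> G' x a & exists c, G' n c].
Proof.
move=> gG; have [G0 GB Gf] := gG.
have [c cP] : exists c, forall e a, e != 0 -> G (n *~ e) a -> a = e%:~R * c.
  have [[e [a [e0 Ge]]]|noe] :=
      pselect (exists e a, e != 0 /\ G (n *~ e) a); last first.
    by exists 0 => e a e0 Ge; case: noe; exists e, a.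
  exists (e%:~R^-1 * a) => e' a' e'0 Ge'.
  have eK0 : e%:~R != 0 :> K by rewrite intr_eq0.
  apply: (mulfI eK0); rewrite mulrCA mulVKf //.
  apply: (partial_hom_fun gG) (partial_homMz e gG Ge') _.
  by rewrite -mulrzA mulrC mulrzA; apply: partial_homMz.
exists (fun x a => exists y b j,
  [/\ G y b, x = y + n *~ j & a = b + j%:~R * c]); split.
- split=> [|x y a b|a].
  + by exists 0, 0, 0; rewrite mul0r mulr0z !addr0.
  + move=> [x' [a' [j [Gx -> ->]]]] [y' [b' [k [Gy -> ->]]]].
    exists (x' - y'), (a' - b'), (j - k); split; first exact: GB.
      by rewrite mulrzBr opprD addrACA.
    by rewrite rmorphB mulrBl opprD addrACA.
  move=> [y [b [j [Gy Ey ->]]]]; have [j0|j0] := eqVneq j 0.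
    move: Gy Ey; rewrite j0 mulr0z mul0r !addr0 => Gy y0.
    by apply: Gf; rewrite y0.
  have E : n *~ j = - y by apply/eqP; rewrite -addr_eq0 addrC -Ey.
  rewrite -(cP j (- b)) ?subrr // E.
  exact: partial_homN.
- by move=> x a Gx; exists x, a, 0; rewrite mulr0z mul0r !addr0.
- by exists c, 0, 0, 1; rewrite mulr1z mul1r !add0r.
Qed.

Lemma partial_hom_extend (s : seq N) G : partial_hom G -> exists G',
  [/\ partial_hom G', forall x a, G x a -> G' x a
    & forall x, zspan s x -> exists c, G' x c].
Proof.
elim: s G => [|n s IHs] G gG.
  by exists G; split=> // x ->; exists 0; case: gG.
have [G1 [gG1 GG1 [c G1n]]] := partial_hom_extend1 n gG.
have [G2 [gG2 GG2 G2s]] := IHs G1 gG1.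
exists G2; split=> // [x a /GG1/GG2 //|x /= [j /G2s[d G2d]]].
have [_ GB _] := gG2.
have /(partial_homN gG2) Gm := partial_homMz j gG2 (GG2 _ _ G1n).
exists (d - - (j%:~R * c)); rewrite -[x](subrK (n *~ j)) -{2}[n *~ j]opprK.
exact: GB.
Qed.

(** Fields of characteristic 0 are divisible, hence injective, groups. *)
Lemma additive_extension (s : seq N) G : (forall x, zspan s x) ->
    partial_hom G ->
  exists psi : {additive N -> K}, forall x a, G x a -> psi x = a.
Proof.
move=> sN /(partial_hom_extend s)[G' [gG' GG' G's]].
have [psi psiP] := choice (fun x => G's x (sN x)).
have psiB : zmod_morphism psi.
  move=> x y; apply: (partial_hom_fun gG') (psiP _) _.
  by case: gG' => _ GB _; apply: GB.
exists (HB.pack_for {additive N -> K} psi (GRing.isZmodMorphism.Build _ _ psi psiB)).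
by move=> x a /GG' Gx; apply: (partial_hom_fun gG') (psiP _) Gx.
Qed.

End Extension.

Lemma vspace_separation (K : fieldType) (V : vectType K) (U : {vspace V}) x :
  x \notin U -> exists2 l : {scalar V}, (forall u, u \in U -> l u = 0) & l x != 0.
Proof.
move=> xU; pose r := (\1 - projv U)%VF.
have rE z : r z = z - projv U z by rewrite add_lfunE opp_lfunE id_lfunE.
have rx0 : r x != 0.
  by apply: contraNneq xU => /eqP; rewrite rE subr_eq0 => /eqP->; apply: memv_proj.
have [i li] : exists i, coord (vbasis {:V}) i (r x) != 0.
  apply: contrapT => no; case/negP: rx0; apply/eqP.
  rewrite (coord_vbasis (memvf (r x))) big1 // => i _.
  have [->|ci] := eqVneq (coord (vbasis {:V}) i (r x)) 0; first exact: scale0r.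
  by case: no; exists i.
exists (coord (vbasis {:V}) i \o r) => // u uU.
by rewrite /= rE projv_id // subrr linear0.
Qed.

Section TensExact.
Variable K : numFieldType.

Lemma tens_lfun_pure (M N : fgZmodType) (f : {additive M -> N}) m a :
  tens_lfun K f (pure_tens m a) = pure_tens (f m) a.
Proof. by rewrite lfunE /= tens_mapl_pure. Qed.

Lemma pure_tensD (M : zmodType) (m n : M) (a : K) :
  pure_tens (m + n) a = pure_tens m a + pure_tens n a.
Proof. exact: (proj1 (pure_tens_biadd M K)). Qed.

Lemma pure_tens0 (M : zmodType) (a : K) : pure_tens (0 : M) a = 0.
Proof. exact: biadd0l (pure_tens_biadd M K). Qed.

Lemma pure_tensE (M : zmodType) (m : M) (a : K) :
  pure_tens m a = a *: pure_tens m 1.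
Proof. by rewrite scale_pure_tens mulr1. Qed.

Lemma tens_lfun_eq (M : fgZmodType) (V : vectType K) (f g : 'Hom(tens M K, V)) :
  (forall m, f (pure_tens m 1) = g (pure_tens m 1)) -> f = g.
Proof.
move=> fg; apply/lfunP; elim/tens_ind=> [|m a x IHx]; first by rewrite !lfun0.
by rewrite !lfunD IHx pure_tensE !linearZ /= fg.
Qed.

Lemma tens_lfunD (M N : fgZmodType) (f g h : {additive M -> N}) :
  (forall x, h x = f x + g x) ->
  tens_lfun K h = tens_lfun K f + tens_lfun K g.
Proof.
move=> hE; apply: tens_lfun_eq => m.
by rewrite add_lfunE !tens_lfun_pure hE pure_tensD.
Qed.

Lemma tens_lfun0 (M N : fgZmodType) (f : {additive M -> N}) :
  (forall x, f x = 0) -> tens_lfun K f = 0.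
Proof.
move=> f0; apply: tens_lfun_eq => m.
by rewrite tens_lfun_pure zero_lfunE f0 pure_tens0.
Qed.

Lemma tens_lfun_compE (L M N : fgZmodType) (f : {additive L -> M})
    (g : {additive M -> N}) (h : {additive L -> N}) :
  (forall x, g (f x) = h x) ->
  forall x, tens_lfun K g (tens_lfun K f x) = tens_lfun K h x.
Proof.
move=> gf x; rewrite -comp_lfunE; congr (fun_of_lfun _ x).
by apply: tens_lfun_eq => m; rewrite comp_lfunE !tens_lfun_pure gf.
Qed.

Lemma tens_lfunK (M N : fgZmodType) (i : {additive M -> N})
    (p : {additive N -> M}) :
  cancel i p -> cancel (tens_lfun K i) (tens_lfun K p).
Proof.
move=> pi x; rewrite -[RHS]id_lfunE -comp_lfunE; congr (fun_of_lfun _ x).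
by apply: tens_lfun_eq => m; rewrite comp_lfunE !tens_lfun_pure id_lfunE pi.
Qed.

Lemma tens_lfun_biprod (M N B : fgZmodType)
    (i1 : {additive M -> B}) (i2 : {additive N -> B})
    (p1 : {additive B -> M}) (p2 : {additive B -> N}) :
  (forall x, i1 (p1 x) + i2 (p2 x) = x) -> forall x,
  tens_lfun K i1 (tens_lfun K p1 x) + tens_lfun K i2 (tens_lfun K p2 x) = x.
Proof.
move=> ip x; rewrite -[RHS]id_lfunE -!comp_lfunE -add_lfunE.
congr (fun_of_lfun _ x); apply: tens_lfun_eq => m.
by rewrite add_lfunE !comp_lfunE !tens_lfun_pure id_lfunE -pure_tensD ip.
Qed.

(** A functional on [tens M K] vanishing on the image of [g] is an additive map
    from [M] to [K] vanishing on the kernel of [f]. It descends to the image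
    of [f] and extends to [N], so it vanishes on the kernel of [tens_lfun K f].
    Functionals separate points and subspaces. *)
Lemma tens_exact (L M N : fgZmodType) (g : {additive L -> M})
    (f : {additive M -> N}) :
  (forall x, f x = 0 <-> exists y, g y = x) ->
  lker (tens_lfun K f) = limg (tens_lfun K g).
Proof.
move=> fg; apply/eqP; rewrite eqEsubv; apply/andP; split; last first.
  apply/subvP => _ /memv_imgP[x _ ->]; rewrite memv_ker.
  elim/tens_ind: x => [|m a x IHx]; first by rewrite !lfun0.
  rewrite !lfunD !tens_lfun_pure.
  have -> : f (g m) = 0 by apply/fg; exists m.
  by rewrite pure_tens0 add0r.
apply/subvP => x; rewrite memv_ker => /eqP fx0; apply/negPn/negP.
move=> /vspace_separation[l lg /eqP[]].
pose phi m := l (pure_tens m 1).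
have phiB : zmod_morphism phi.
  move=> m n; rewrite /phi -linearB /=; congr (l _).
  by apply/(addIr (pure_tens n 1)); rewrite -pure_tensD !subrK.
pose phiA := HB.pack_for {additive M -> K} phi
  (GRing.isZmodMorphism.Build _ _ phi phiB).
pose G y a := exists2 m, f m = y & phi m = a.
have gG : partial_hom G.
  split; first by exists 0; [exact: raddf0 | exact: (raddf0 phiA)].
    move=> _ _ _ _ [m <- <-] [n <- <-]; exists (m - n); first exact: raddfB.
    exact: phiB.
  move=> _ [m /fg[k <-] <-]; rewrite /phi -tens_lfun_pure.
  by apply: lg; rewrite memv_img ?memvf.
have [s sN] := fg_zspan N; have [psi psiP] := additive_extension sN gG.
pose b y a := psi y * a.
have bb : biadditive b.
  by split=> *; rewrite /b ?raddfD ?mulrDl // mulrDr.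
have lE z : l z = tens_rec b (tens_lfun K f z).
  elim/tens_ind: z => [|m a z IHz].
    by rewrite linear0 lfun0 (tens_rec_pi [::] bb) big_nil.
  rewrite linearD /= IHz lfunD tens_recD // tens_lfun_pure tens_rec_pure //.
  rewrite /b (psiP _ (phi m)); last by exists m.
  by rewrite pure_tensE linearZ /= mulrC.
by rewrite lE fx0 (tens_rec_pi [::] bb) big_nil.
Qed.

Lemma tens_injective (M N : fgZmodType) (f : {additive M -> N}) :
  injective f -> injective (tens_lfun K f).
Proof.
move=> fI; apply/lker0P.
have -> : lker (tens_lfun K f) = limg (tens_lfun K (\0 : M -> M)).
  apply: tens_exact => x.
  split=> [fx0|[y <-]]; last by rewrite /= raddf0.
  by exists 0; apply: fI; rewrite fx0 /= raddf0.
by rewrite tens_lfun0 // lim0g.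
Qed.

Lemma tens_surjective (M N : fgZmodType) (f : {additive M -> N}) :
  (forall y, exists x, f x = y) -> limg (tens_lfun K f) = fullv.
Proof.
move=> fS; apply/vspaceP => y; rewrite memvf.
elim/tens_ind: y => [|m a y IHy]; first exact: mem0v.
have [x <-] := fS m; rewrite memvD // -tens_lfun_pure.
by rewrite memv_img ?memvf.
Qed.

End TensExact.

(** * Extension of scalars from the rationals to the complex numbers *)

Section Complexify.
Variable R : realType.
Local Notation C := R[i].

Lemma tens_ratCD (M : fgZmodType) : {morph @tens_ratC R M : x y / x + y}.
Proof. exact: tens_mapD. Qed.

Lemma tens_ratC0 (M : fgZmodType) : @tens_ratC R M 0 = 0.
Proof. exact: (raddf0 (tens_map (@idfun M) (@ratr C))). Qed.

Lemma tens_ratC_pure (M : fgZmodType) (m : M) a :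
  tens_ratC R (pure_tens m a) = pure_tens m (ratr a).
Proof. exact: (tens_map_pure (@idfun M) (@ratr C)). Qed.

Lemma tens_ratCZ (M : fgZmodType) a (x : tens M rat) :
  tens_ratC R (a *: x) = ratr a *: tens_ratC R x.
Proof.
elim/tens_ind: x => [|m c x IHx]; first by rewrite scaler0 tens_ratC0 scaler0.
rewrite scalerDr !tens_ratCD IHx scalerDr; congr (_ + _).
by rewrite scale_pure_tens !tens_ratC_pure scale_pure_tens rmorphM.
Qed.

Lemma tens_ratCB (M : fgZmodType) (x y : tens M rat) :
  tens_ratC R (x - y) = tens_ratC R x - tens_ratC R y.
Proof.
rewrite -scaleN1r tens_ratCD tens_ratCZ.
by rewrite rmorphN rmorph1 scaleN1r.
Qed.

Lemma tens_ratC1 (M : fgZmodType) (m : M) :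
  tens_ratC R (pure_tens m 1) = pure_tens m 1.
Proof. by rewrite tens_ratC_pure rmorph1. Qed.

(** A rational functional that does not kill [x] extends to a complex one that
    does not kill its image. *)
Lemma tens_ratC_inj (M : fgZmodType) (x : tens M rat) :
  tens_ratC R x = 0 -> x = 0.
Proof.
move=> x0; apply/eqP/negPn/negP; rewrite -memv0 => /vspace_separation[l _].
pose b (m : M) (a : C) := ratr (l (pure_tens m 1)) * a.
have bb : biadditive b.
  by split=> *; rewrite /b ?mulrDr // pure_tensD linearD /= rmorphD mulrDl.
have lE z : ratr (l z) = tens_rec b (tens_ratC R z).
  elim/tens_ind: z => [|m a z IHz].
    by rewrite linear0 rmorph0 tens_ratC0 (tens_rec_pi [::] bb) big_nil.
  rewrite linearD /= rmorphD /= IHz tens_ratCD tens_recD // tens_ratC_pure.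
  rewrite tens_rec_pure // /b pure_tensE linearZ /= rmorphM.
  by rewrite [in LHS]mulrC.
have /eqP := lE x; rewrite x0 (tens_rec_pi [::] bb) big_nil fmorph_eq0.
by move=> ->.
Qed.

Definition extends_ratC (M N : fgZmodType) (g : 'Hom(tens M rat, tens N rat))
    (h : 'Hom(tens M C, tens N C)) : Prop :=
  forall x, h (tens_ratC R x) = tens_ratC R (g x).

(** The tensors [pure_tens m 1] are rational and generate [tens M C]. *)
Lemma extends_ratC_exists (M N : fgZmodType) (g : 'Hom(tens M rat, tens N rat)) :
  exists h, extends_ratC g h.
Proof.
pose b (m : M) (a : C) := a *: tens_ratC R (g (pure_tens m 1)).
have bb : biadditive b.
  split=> *; rewrite /b; last by rewrite scalerDl.
  by rewrite pure_tensD lfunD tens_ratCD scalerDr.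
have bL : linear (tens_rec b).
  move=> a x y; rewrite tens_recD //; congr (_ + _).
  elim/tens_ind: x => [|m c x IHx].
    by rewrite scaler0 (tens_rec_pi [::] bb) big_nil scaler0.
  rewrite scalerDr !tens_recD // IHx scalerDr scale_pure_tens.
  by rewrite !tens_rec_pure // /b scalerA.
pose bH := HB.pack_for {linear tens M C -> tens N C} (tens_rec b)
  (GRing.isLinear.Build C _ _ _ (tens_rec b) bL).
exists (linfun bH) => x; rewrite lfunE /=.
elim/tens_ind: x => [|m a x IHx].
  by rewrite tens_ratC0 lfun0 tens_ratC0 (tens_rec_pi [::] bb) big_nil.
rewrite tens_ratCD tens_recD // IHx lfunD tens_ratCD; congr (_ + _).
by rewrite tens_ratC_pure tens_rec_pure // /b (pure_tensE m a) linearZ tens_ratCZ.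
Qed.

Lemma extends_ratC_tens (M N : fgZmodType) (f : {additive M -> N}) :
  extends_ratC (tens_lfun rat f) (tens_lfun C f).
Proof.
elim/tens_ind=> [|m a x IHx]; first by rewrite !(tens_ratC0, lfun0).
by rewrite !(lfunD, tens_ratCD) IHx tens_ratC_pure !tens_lfun_pure tens_ratC_pure.
Qed.

Section Subspaces.
Variable M : fgZmodType.
Implicit Types U : {vspace tens M rat}.

Lemma memv_complexify U x : x \in U -> tens_ratC R x \in complexify R U.
Proof.
move=> /coord_vbasis->; rewrite (big_morph _ (@tens_ratCD M) (tens_ratC0 M)).
apply: memv_suml => i _; rewrite tens_ratCZ memvZ //.
by apply/memv_span/map_f/mem_nth; rewrite size_tuple.
Qed.

Lemma complexify_subv U (T : {vspace tens M C}) :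
  (forall x, x \in U -> tens_ratC R x \in T) -> (complexify R U <= T)%VS.
Proof. by move=> UT; apply/span_subvP => _ /mapP[x /vbasis_mem xU ->]; apply: UT. Qed.

Lemma complexifyS U U' : (U <= U')%VS -> (complexify R U <= complexify R U')%VS.
Proof.
by move=> UU'; apply: complexify_subv => x /(subvP UU'); apply: memv_complexify.
Qed.

Lemma complexify0 : complexify R (0%VS : {vspace tens M rat}) = 0%VS.
Proof.
apply/eqP; rewrite -subv0; apply: complexify_subv => x.
by rewrite !memv0 => /eqP->; rewrite tens_ratC0.
Qed.

Lemma complexifyf : complexify R (fullv : {vspace tens M rat}) = fullv.
Proof.
apply/vspaceP => x; rewrite memvf; elim/tens_ind: x => [|m a x IHx].
  exact: mem0v.
by rewrite memvD // pure_tensE memvZ // -tens_ratC1 memv_complexify ?memvf.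
Qed.

Lemma complexifyD U U' :
  complexify R (U + U')%VS = (complexify R U + complexify R U')%VS.
Proof.
apply/eqP; rewrite eqEsubv subv_add !complexifyS ?addvSl ?addvSr // !andbT.
apply: complexify_subv => _ /memv_addP[x xU [y yU' ->]].
by rewrite tens_ratCD memv_add ?memv_complexify.
Qed.

End Subspaces.

Section Maps.
Variables (M N : fgZmodType) (g : 'Hom(tens M rat, tens N rat)).
Variable h : 'Hom(tens M C, tens N C).
Hypothesis gh : extends_ratC g h.

Lemma complexify_limg U : complexify R (g @: U)%VS = (h @: complexify R U)%VS.
Proof.
apply/eqP; rewrite eqEsubv; apply/andP; split.
  apply: complexify_subv => _ /memv_imgP[x xU ->].
  by rewrite -gh memv_img ?memv_complexify.
rewrite limg_span; apply/span_subvP => _ /mapP[_ /mapP[x /vbasis_mem xU ->] ->].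
by rewrite gh memv_complexify ?memv_img.
Qed.

(** If [s] is a pseudo-inverse of [g], the kernel of [g] is the image of
    [1 - s \o g], and this formula is preserved by extension of scalars. *)
Lemma complexify_lker : complexify R (lker g) = lker h.
Proof.
apply/eqP; rewrite eqEsubv; apply/andP; split.
  apply: complexify_subv => x; rewrite !memv_ker gh => /eqP->.
  by rewrite tens_ratC0.
have [s gs] := extends_ratC_exists (g^-1)%VF.
apply/subvP => y; rewrite memv_ker => /eqP hy0.
have -> : y = y - s (h y) by rewrite hy0 lfun0 subr0.
elim/tens_ind: y {hy0} => [|m a y IHy]; first by rewrite !lfun0 subr0 mem0v.
rewrite !lfunD opprD addrACA memvD // pure_tensE.
have -> : s (h (a *: pure_tens m 1)) = a *: s (h (pure_tens m 1)).
  by rewrite !linearZ.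
rewrite -scalerBr memvZ //.
rewrite -tens_ratC1 gh gs -tens_ratCB memv_complexify // memv_ker lfunB.
by rewrite -[g (_ (g _))]comp_lfunE -[(g \o _)%VF (g _)]comp_lfunE inv_lfun_def subrr.
Qed.

End Maps.

(** A subspace is the kernel of a projection, so its preimages are kernels. *)
Lemma complexify_preim (M N : fgZmodType) (g : 'Hom(tens M rat, tens N rat)) h U :
  extends_ratC g h ->
  complexify R (g @^-1: U)%VS = (h @^-1: complexify R U)%VS.
Proof.
move=> gh; pose r := (\1 - projv U)%VF.
have rU : lker r = U.
  apply/vspaceP => x; rewrite memv_ker add_lfunE opp_lfunE id_lfunE subr_eq0.
  apply/eqP/idP => [->|xU]; [exact: memv_proj | by rewrite projv_id].
have [t rt] := extends_ratC_exists r.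
have -> : (g @^-1: U)%VS = lker (r \o g)%VF.
  by apply/vspaceP => x; rewrite -memv_preim -{1}rU !memv_ker comp_lfunE.
rewrite (@complexify_lker _ _ _ (t \o h)%VF); last first.
  by move=> x; rewrite !comp_lfunE gh rt.
apply/vspaceP => x; rewrite -memv_preim -rU (complexify_lker rt) !memv_ker.
by rewrite comp_lfunE.
Qed.

Lemma complexify_mem (M : fgZmodType) (U : {vspace tens M rat}) x :
  (tens_ratC R x \in complexify R U) = (x \in U).
Proof.
apply/idP/idP=> [|xU]; last exact: memv_complexify.
pose r := (\1 - projv U)%VF.
have rU y : (r y == 0) = (y \in U).
  rewrite add_lfunE opp_lfunE id_lfunE subr_eq0.
  apply/eqP/idP => [->|yU]; [exact: memv_proj | by rewrite projv_id].
have [t rt] := extends_ratC_exists r.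
have -> : U = lker r by apply/vspaceP => y; rewrite memv_ker rU.
rewrite (complexify_lker rt) !memv_ker rt => /eqP/tens_ratC_inj->.
exact: eqxx.
Qed.

End Complexify.

(** * Mixed Hodge structures *)

Section MixedHodge.
Variable R : realType.
Local Notation C := R[i].

Section Conjugation.
Variable M : fgZmodType.
Implicit Types U : {vspace tens M C}.

Lemma memv_conjv U x : (x \in conjv U) = (tens_conj x \in U).
Proof. by rewrite -memv_conj tens_conjK. Qed.

Lemma conjvD U U' : conjv (U + U')%VS = (conjv U + conjv U')%VS.
Proof.
apply/vspaceP => x; rewrite memv_conjv; apply/memv_addP/memv_addP.
  move=> [a aU [b bU' E]]; exists (tens_conj a); first by rewrite memv_conj.
  exists (tens_conj b); first by rewrite memv_conj.
  by rewrite -tens_conjD -E tens_conjK.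
move=> [a aU [b bU' ->]]; rewrite !memv_conjv in aU bU'.
by exists (tens_conj a) => //; exists (tens_conj b); rewrite // tens_conjD.
Qed.

Lemma conjvI U U' : conjv (U :&: U')%VS = (conjv U :&: conjv U')%VS.
Proof. by apply/vspaceP => x; rewrite memv_cap !memv_conjv memv_cap. Qed.

Lemma conjvS U U' : (U <= U')%VS -> (conjv U <= conjv U')%VS.
Proof. by move=> /subvP UU'; apply/subvP => x; rewrite !memv_conjv => /UU'. Qed.

Lemma tens_conj_ratC (x : tens M rat) :
  tens_conj (tens_ratC R x) = tens_ratC R x.
Proof.
elim/tens_ind: x => [|m a x IHx]; first by rewrite tens_ratC0 tens_conj0.
rewrite tens_ratCD tens_conjD IHx tens_ratC_pure tens_conj_pure.
by congr (pure_tens m _ + _); apply: fmorph_rat.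
Qed.

Lemma conjv_complexify (U : {vspace tens M rat}) :
  conjv (complexify R U) = complexify R U.
Proof.
have sub : (complexify R U <= conjv (complexify R U))%VS.
  apply: complexify_subv => x xU.
  by rewrite memv_conjv tens_conj_ratC memv_complexify.
apply/eqP; rewrite eqEsubv sub andbT; apply/subvP => x.
by rewrite memv_conjv => /(subvP sub); rewrite memv_conj.
Qed.

End Conjugation.

Lemma tens_conj_lfun (M N : fgZmodType) (f : {additive M -> N}) x :
  tens_conj (tens_lfun C f x) = tens_lfun C f (tens_conj x).
Proof.
elim/tens_ind: x => [|m a x IHx]; first by rewrite lfun0 !tens_conj0 lfun0.
rewrite lfunD !tens_conjD lfunD IHx.
by rewrite tens_lfun_pure !tens_conj_pure tens_lfun_pure.
Qed.

Lemma conjv_preim (M N : fgZmodType) (f : {additive M -> N}) U :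
  conjv (tens_lfun C f @^-1: U)%VS = (tens_lfun C f @^-1: conjv U)%VS.
Proof.
by apply/vspaceP => x; rewrite memv_conjv -!memv_preim memv_conjv tens_conj_lfun.
Qed.

Lemma conjv_limg (M N : fgZmodType) (f : {additive M -> N}) U :
  conjv (tens_lfun C f @: U)%VS = (tens_lfun C f @: conjv U)%VS.
Proof.
apply/vspaceP => x; rewrite memv_conjv; apply/memv_imgP/memv_imgP.
  move=> [y yU E]; exists (tens_conj y); first by rewrite memv_conj.
  by rewrite -tens_conj_lfun -E tens_conjK.
move=> [y]; rewrite memv_conjv => yU ->; exists (tens_conj y) => //.
exact: tens_conj_lfun.
Qed.

(** The weight filtration is rational, hence stable under conjugation, so the
    conjugate of [hodge_gr] is the filtration that the conjugate of [F] induces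
    on the graded pieces. *)
Lemma pure_gr_opposed (M : fgZmodType) (W : int -> {vspace tens M rat})
    (F : int -> {vspace tens M C}) :
  (forall m n, m <= n -> (W m <= W n)%VS) ->
  (forall n, pure_gr W F n) <->
  opposed (fun n => complexify R (W n)) F (fun q => conjv (F q)).
Proof.
move=> Wincr.
have W1 n : (complexify R (W (n - 1)) <= complexify R (W n))%VS.
  by apply/complexifyS/Wincr; int_lia.
have conj_gr n q : conjv (hodge_gr W F n q) =
    ((conjv (F q) :&: complexify R (W n)) + complexify R (W (n - 1)))%VS.
  by rewrite conjvD conjvI !conjv_complexify.
split=> [pureW|[sumW capW] n p q pq].
  split=> n p q pq.
    move=> x; have [E _] := pureW n p q pq.
    rewrite -{1}E conj_gr => /memv_addP[_ /memv_addP[a aP [c cP ->]]].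
    move=> [_ /memv_addP[b bP [d dP ->]] ->].
    move: aP bP; rewrite !memv_cap => /andP[aF aW] /andP[bF bW].
    exists a, b, (c + d); split=> //.
    split; first by rewrite memvD.
    by rewrite addrACA.
  move=> a b aF aW bG bW abW; have [_ E] := pureW n p q pq.
  rewrite -E conj_gr memv_cap; apply/andP; split.
    by rewrite -[a]addr0 memv_add ?mem0v // memv_cap aF.
  by rewrite -[a](subrK b) addrC memv_add // memv_cap bG.
rewrite conj_gr /hodge_gr; split; apply/eqP; rewrite eqEsubv; apply/andP; split.
- by rewrite !subv_add !capvSr !W1.
- apply/subvP => x xW.
  have [a [b [c [[aF aW bG bW] [cW ->]]]]] := sumW n p q pq x xW.
  rewrite -addrA memv_add //; first by rewrite -[a]addr0 memv_add ?mem0v ?memv_cap ?aF.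
  by rewrite memv_add // memv_cap bG.
- apply/subvP => x /memv_capP[/memv_addP[a]].
  rewrite memv_cap => /andP[aF aW] [c cW ->] /memv_addP[b].
  rewrite memv_cap => /andP[bG bW] [d dW E].
  rewrite memvD //; apply: (capW n p q pq a b) => //.
  have -> : a - b = d - c; last exact: memvB.
  by apply/eqP; rewrite subr_eq addrAC eq_sym subr_eq [d + b]addrC E.
- by rewrite subv_cap !addvSr.
Qed.

Implicit Types H : mhs R.

Lemma mhs_opposed H : opposed_filtrations
  (fun n => complexify R (weight H n)) (hodge H) (fun q => conjv (hodge H q)).
Proof.
split.
- by move=> m n mn; apply/complexifyS/weight_incr.
- by have [n Wn] := weight_bot H; exists n; rewrite Wn complexify0.
- exact: hodge_decr.
- by move=> p q pq; apply/conjvS/hodge_decr.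
- by apply/pure_gr_opposed; [apply: weight_incr | apply: gr_pure].
Qed.

Lemma weight_topC H : exists n, complexify R (weight H n) = fullv.
Proof. by have [n Wn] := weight_top H; exists n; rewrite Wn complexifyf. Qed.

Section Morphism.
Variables (H H' : mhs R) (f : mhs_hom H H').

Definition fQ : 'Hom(tens (HZ H) rat, tens (HZ H') rat) := tens_lfun rat (fZ f).

Lemma fQ_weight n x : x \in weight H n -> fQ x \in weight H' n.
Proof. by move=> xW; apply: (subvP (fZ_weight f n)); apply: memv_img. Qed.

Lemma fC_hodge p x : x \in hodge H p -> fC f x \in hodge H' p.
Proof. by move=> xF; apply: (subvP (fZ_hodge f p)); apply: memv_img. Qed.

Lemma fC_weight n x : x \in complexify R (weight H n) ->
  fC f x \in complexify R (weight H' n).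
Proof.
move=> xW; apply: (subvP (complexifyS R (fZ_weight f n))).
by rewrite (complexify_limg (extends_ratC_tens _ _)) memv_img.
Qed.

Lemma fC_conj q x : x \in conjv (hodge H q) -> fC f x \in conjv (hodge H' q).
Proof. by rewrite !memv_conjv tens_conj_lfun => /fC_hodge. Qed.

Lemma mhs_strict_hodge p x : fC f x \in hodge H' p ->
  exists2 a, a \in hodge H p & fC f a = fC f x.
Proof.
move=> fxF; have [n Wn] := weight_topC H.
have [|a [aF _] fa] := filtered_strict_F (mhs_opposed H) (mhs_opposed H')
  fC_weight fC_hodge fC_conj (m := n) (x := x) _ fxF.
  by rewrite Wn memvf.
by exists a.
Qed.

(** Membership in a rational subspace can be tested over the complex numbers,
    where strictness is available. *)
Lemma mhs_strict_weight n x : fQ x \in weight H' n ->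
  exists2 a, a \in weight H n & fQ a = fQ x.
Proof.
move=> fxW; suff /memv_imgP[a aW fa] : fQ x \in (fQ @: weight H n)%VS.
  by exists a.
rewrite -(complexify_mem R) (complexify_limg (extends_ratC_tens _ _)).
rewrite -(extends_ratC_tens R).
have [m Wm] := weight_topC H.
have [||a aW <-] := filtered_strict_W (mhs_opposed H) (mhs_opposed H')
  fC_weight fC_hodge fC_conj (hodge_top H) (hodge_bot H)
  (m := m) (n := n) (x := tens_ratC R x).
- by rewrite Wm memvf.
- by rewrite /fC extends_ratC_tens complexify_mem.
- exact: memv_img.
Qed.

End Morphism.

Definition exact_at (A B D : zmodType) (g : A -> B) (f : B -> D) : Prop :=
  forall x, f x = 0 <-> exists y, g y = x.

Lemma fC_exact (L H H' : mhs R) (k : mhs_hom L H) (f : mhs_hom H H') :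
  exact_at (fZ k) (fZ f) -> lker (fC f) = limg (fC k).
Proof. exact: tens_exact. Qed.

Lemma lpreimf (K : fieldType) (U V : vectType K) (f : 'Hom(U, V)) :
  (f @^-1: fullv)%VS = fullv.
Proof. by apply/vspaceP => x; rewrite -memv_preim !memvf. Qed.

Lemma lpreim_inj0 (K : fieldType) (U V : vectType K) (f : 'Hom(U, V)) :
  injective f -> (f @^-1: 0)%VS = 0%VS.
Proof. by move=> fI; apply/eqP; rewrite lpreim0; apply/lker0P. Qed.

Lemma fC_comp (L H T : mhs R) (f : mhs_hom L H) (g : mhs_hom H T)
    (h : mhs_hom L T) :
  (forall x, fZ g (fZ f x) = fZ h x) -> forall x, fC g (fC f x) = fC h x.
Proof. exact: tens_lfun_compE. Qed.

Lemma fC_inj (H H' : mhs R) (f : mhs_hom H H') :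
  injective (fZ f) -> injective (fC f).
Proof. exact: tens_injective. Qed.

Lemma fC_surj (H H' : mhs R) (f : mhs_hom H H') :
  (forall y, exists x, fZ f x = y) -> forall y, exists x, fC f x = y.
Proof.
move=> fS y; have := memvf y; rewrite -(tens_surjective C fS).
by move=> /memv_imgP[x _ ->]; exists x.
Qed.

(** Take the subgroup [ker (fZ f)] with the filtrations induced by those of [H].
    Since preimages commute with extension of scalars and with conjugation, its
    graded pieces are pure by [opposed_kernel]. *)
Lemma mhs_kernel (H H' : mhs R) (f : mhs_hom H H') :
  exists (L : mhs R) (k : mhs_hom L H), injective (fZ k) /\ exact_at (fZ k) (fZ f).
Proof.
pose i := @ker_incl _ _ (fZ f); pose iQ := tens_lfun rat i; pose iC := tens_lfun C i.
pose W n := (iQ @^-1: weight H n)%VS; pose F p := (iC @^-1: hodge H p)%VS.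
have iI : injective i by apply: ker_incl_inj.
have iQI : injective iQ by apply: tens_injective.
have iCI : injective iC by apply: tens_injective.
have iE : exact_at i (fZ f) by move=> x; apply: ker_inclP.
have Wincr m n : m <= n -> (W m <= W n)%VS by move=> mn; apply/lpreimS/weight_incr.
have Wbot : exists n, W n = 0%VS.
  by have [n Wn] := weight_bot H; exists n; rewrite /W Wn lpreim_inj0.
have Wtop : exists n, W n = fullv.
  by have [n Wn] := weight_top H; exists n; rewrite /W Wn lpreimf.
have Fdecr p q : p <= q -> (F q <= F p)%VS by move=> pq; apply/lpreimS/hodge_decr.
have Ftop : exists p, F p = fullv.
  by have [p Fp] := hodge_top H; exists p; rewrite /F Fp lpreimf.
have Fbot : exists p, F p = 0%VS.
  by have [p Fp] := hodge_bot H; exists p; rewrite /F Fp lpreim_inj0.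
have pureW : forall n, pure_gr W F n.
  apply/(pure_gr_opposed _ Wincr).
  have := opposed_kernel (mhs_opposed H) (mhs_opposed H')
    (@fC_weight _ _ f) (@fC_hodge _ _ f) (@fC_conj _ _ f) iCI
    (esym (tens_exact C iE)).
  congr opposed; apply/funext => n.
    by rewrite /W (complexify_preim _ (extends_ratC_tens R i)).
  by rewrite conjv_preim.
pose L := MHS Wincr Wbot Wtop Fdecr Ftop Fbot pureW.
have kW n : (tens_lfun rat i @: weight L n <= weight H n)%VS.
  by apply/subvP => _ /memv_imgP[x xW ->]; rewrite memv_preim.
have kF p : (tens_lfun C i @: hodge L p <= hodge H p)%VS.
  by apply/subvP => _ /memv_imgP[x xF ->]; rewrite memv_preim.
by exists L, (@MHSHom R L H i kW kF).
Qed.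

(** Take the quotient of [HZ H'] by the image of [fZ f], with the images of the
    filtrations of [H']. Since images commute with extension of scalars and with
    conjugation, its graded pieces are pure by [opposed_cokernel]. *)
Lemma mhs_cokernel (H H' : mhs R) (f : mhs_hom H H') :
  exists (L : mhs R) (r : mhs_hom H' L),
    (forall z, exists y, fZ r y = z) /\ exact_at (fZ f) (fZ r).
Proof.
pose r := @coker_proj _ _ (fZ f); pose rQ := tens_lfun rat r; pose rC := tens_lfun C r.
pose W n := (rQ @: weight H' n)%VS; pose F p := (rC @: hodge H' p)%VS.
have rS : forall z, exists y, r y = z by apply: coker_proj_surj.
have rQS : limg rQ = fullv by apply: tens_surjective.
have rCS : limg rC = fullv by apply: tens_surjective.
have rE : exact_at (fZ f) r by move=> x; apply: coker_projP.
have Wincr m n : m <= n -> (W m <= W n)%VS by move=> mn; apply/limgS/weight_incr.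
have Wbot : exists n, W n = 0%VS.
  by have [n Wn] := weight_bot H'; exists n; rewrite /W Wn limg0.
have Wtop : exists n, W n = fullv.
  by have [n Wn] := weight_top H'; exists n; rewrite /W Wn.
have Fdecr p q : p <= q -> (F q <= F p)%VS by move=> pq; apply/limgS/hodge_decr.
have Ftop : exists p, F p = fullv.
  by have [p Fp] := hodge_top H'; exists p; rewrite /F Fp.
have Fbot : exists p, F p = 0%VS.
  by have [p Fp] := hodge_bot H'; exists p; rewrite /F Fp limg0.
have pureW : forall n, pure_gr W F n.
  apply/(pure_gr_opposed _ Wincr).
  have := opposed_cokernel (mhs_opposed H) (mhs_opposed H')
    (@fC_weight _ _ f) (@fC_hodge _ _ f) (@fC_conj _ _ f)
    (weight_topC H) (hodge_top H) (hodge_bot H) (tens_exact C rE).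
  congr opposed; apply/funext => n.
    by rewrite /W (complexify_limg (extends_ratC_tens R r)).
  by rewrite conjv_limg.
pose L := MHS Wincr Wbot Wtop Fdecr Ftop Fbot pureW.
by exists L, (@MHSHom R H' L r (fun n => subvv _) (fun p => subvv _)).
Qed.

Lemma mhs_biproduct (H H' : mhs R) : exists (B : mhs R)
    (i1 : mhs_hom H B) (i2 : mhs_hom H' B) (p1 : mhs_hom B H) (p2 : mhs_hom B H'),
  [/\ forall x, fZ p1 (fZ i1 x) = x, forall x, fZ p2 (fZ i2 x) = x
    & forall x, fZ i1 (fZ p1 x) + fZ i2 (fZ p2 x) = x].
Proof.
pose B : fgZmodType := (HZ H * HZ H')%type.
pose i1 : {additive HZ H -> B} := @prod_inl (HZ H) (HZ H').
pose i2 : {additive HZ H' -> B} := @prod_inr (HZ H) (HZ H').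
pose p1 : {additive B -> HZ H} := @fst (HZ H) (HZ H').
pose p2 : {additive B -> HZ H'} := @snd (HZ H) (HZ H').
have pi1 x : p1 (i1 x) = x by [].
have pi2 x : p2 (i2 x) = x by [].
have ip x : i1 (p1 x) + i2 (p2 x) = x by apply: prod_inD.
pose W n := (tens_lfun rat i1 @: weight H n + tens_lfun rat i2 @: weight H' n)%VS.
pose F p := (tens_lfun C i1 @: hodge H p + tens_lfun C i2 @: hodge H' p)%VS.
have memW n x : (x \in W n) =
    (tens_lfun rat p1 x \in weight H n) && (tens_lfun rat p2 x \in weight H' n).
  by apply: memv_biprod; [apply: tens_lfunK | apply: tens_lfunK | apply: tens_lfun_biprod].
have memF p x : (x \in F p) =
    (tens_lfun C p1 x \in hodge H p) && (tens_lfun C p2 x \in hodge H' p).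
  by apply: memv_biprod; [apply: tens_lfunK | apply: tens_lfunK | apply: tens_lfun_biprod].
have Wincr m n : m <= n -> (W m <= W n)%VS.
  by move=> mn; apply: addvS; apply/limgS/weight_incr.
have Fdecr p q : p <= q -> (F q <= F p)%VS.
  by move=> pq; apply: addvS; apply/limgS/hodge_decr.
have Wbot : exists n, W n = 0%VS.
  have [n Wn] := weight_bot H; have [n' Wn'] := weight_bot H'.
  exists (Num.min n n'); apply/eqP; rewrite -subv0.
  suff <- : (tens_lfun rat i1 @: weight H n + tens_lfun rat i2 @: weight H' n')%VS = 0%VS.
    by apply: addvS; apply/limgS/weight_incr; int_lia.
  by rewrite Wn Wn' !limg0 addv0.
have Wtop : exists n, W n = fullv.
  have [n Wn] := weight_top H; have [n' Wn'] := weight_top H'.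
  exists (Num.max n n'); apply/vspaceP => x; rewrite memvf memW.
  apply/andP; split.
    by have := memvf (tens_lfun rat p1 x); rewrite -Wn; apply/subvP/weight_incr; int_lia.
  by have := memvf (tens_lfun rat p2 x); rewrite -Wn'; apply/subvP/weight_incr; int_lia.
have Fbot : exists p, F p = 0%VS.
  have [n Fn] := hodge_bot H; have [n' Fn'] := hodge_bot H'.
  exists (Num.max n n'); apply/eqP; rewrite -subv0.
  suff <- : (tens_lfun C i1 @: hodge H n + tens_lfun C i2 @: hodge H' n')%VS = 0%VS.
    by apply: addvS; apply/limgS/hodge_decr; int_lia.
  by rewrite Fn Fn' !limg0 addv0.
have Ftop : exists p, F p = fullv.
  have [n Fn] := hodge_top H; have [n' Fn'] := hodge_top H'.
  exists (Num.min n n'); apply/vspaceP => x; rewrite memvf memF.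
  apply/andP; split.
    by have := memvf (tens_lfun C p1 x); rewrite -Fn; apply/subvP/hodge_decr; int_lia.
  by have := memvf (tens_lfun C p2 x); rewrite -Fn'; apply/subvP/hodge_decr; int_lia.
have pureW : forall n, pure_gr W F n.
  apply/(pure_gr_opposed _ Wincr).
  have := opposed_biprod (tens_lfunK (K := C) pi1) (tens_lfunK (K := C) pi2)
    (tens_lfun_biprod (K := C) ip)
    (fil_opp (mhs_opposed H)) (fil_opp (mhs_opposed H')).
  congr opposed; apply/funext => n.
    by rewrite /W complexifyD !(complexify_limg (extends_ratC_tens R _)).
  by rewrite conjvD !conjv_limg.
pose S := MHS Wincr Wbot Wtop Fdecr Ftop Fbot pureW.
exists S, (@MHSHom R H S i1 (fun n => addvSl _ _) (fun p => addvSl _ _)),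
  (@MHSHom R H' S i2 (fun n => addvSr _ _) (fun p => addvSr _ _)).
have p1W n : (tens_lfun rat p1 @: weight S n <= weight H n)%VS.
  by apply/subvP => _ /memv_imgP[x + ->]; rewrite memW => /andP[].
have p1F p : (tens_lfun C p1 @: hodge S p <= hodge H p)%VS.
  by apply/subvP => _ /memv_imgP[x + ->]; rewrite memF => /andP[].
have p2W n : (tens_lfun rat p2 @: weight S n <= weight H' n)%VS.
  by apply/subvP => _ /memv_imgP[x + ->]; rewrite memW => /andP[].
have p2F p : (tens_lfun C p2 @: hodge S p <= hodge H' p)%VS.
  by apply/subvP => _ /memv_imgP[x + ->]; rewrite memF => /andP[].
by exists (@MHSHom R S H p1 p1W p1F), (@MHSHom R S H' p2 p2W p2F).
Qed.

Lemma tens_trivial (K : numFieldType) (M : fgZmodType) (x : tens M K) :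
  (forall m : M, m = 0) -> x = 0.
Proof.
move=> M0; elim/tens_ind: x => [//|m a x ->].
by rewrite [m]M0 pure_tens0 addr0.
Qed.

Lemma mhs_zero : exists Z : mhs R, forall x : HZ Z, x = 0.
Proof.
pose W (n : int) : {vspace tens zero_group rat} := 0%VS.
pose F (n : int) : {vspace tens zero_group C} := 0%VS.
have triv (K : numFieldType) (U U' : {vspace tens zero_group K}) : U = U'.
  by apply/vspaceP => x; rewrite (tens_trivial x zero_groupE) !mem0v.
have Wincr m n : m <= n -> (W m <= W n)%VS by [].
have Fdecr m n : m <= n -> (F n <= F m)%VS by [].
have WE U : exists n, W n = U by exists 0; apply: triv.
have FE U : exists n, F n = U by exists 0; apply: triv.
have pureW n : pure_gr W F n by move=> p q _; split; apply: triv.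
by exists (MHS Wincr (WE _) (WE _) Fdecr (FE _) (FE _) pureW); apply: zero_groupE.
Qed.

(** By strictness of [k], the filtrations of [L] are induced by those of [H], so
    that any lift of [g] respects them. *)
Lemma mhs_lift (L H T : mhs R) (k : mhs_hom L H) (g : mhs_hom T H) :
    injective (fZ k) -> (forall x, exists y, fZ k y = fZ g x) ->
  exists u : mhs_hom T L, forall x, fZ k (fZ u x) = fZ g x.
Proof.
move=> kI /choice[u0 ku].
have uB : zmod_morphism u0.
  by move=> x y; apply: kI; rewrite raddfB !ku raddfB.
pose u := HB.pack_for {additive HZ T -> HZ L} u0
  (GRing.isZmodMorphism.Build _ _ u0 uB).
have tku (K : numFieldType) x :
    tens_lfun K (fZ k) (tens_lfun K u x) = tens_lfun K (fZ g) x.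
  by apply: tens_lfun_compE; apply: ku.
have uW n : (tens_lfun rat u @: weight T n <= weight L n)%VS.
  apply/subvP => _ /memv_imgP[x xW ->].
  have [|a aW] := @mhs_strict_weight _ _ k n (tens_lfun rat u x).
    by rewrite /fQ tku fQ_weight.
  by move/(tens_injective kI) => <-.
have uF p : (tens_lfun C u @: hodge T p <= hodge L p)%VS.
  apply/subvP => _ /memv_imgP[x xF ->].
  have [|a aF] := @mhs_strict_hodge _ _ k p (tens_lfun C u x).
    by rewrite /fC tku fC_hodge.
  by move/(fC_inj kI) => <-.
by exists (@MHSHom R T L u uW uF).
Qed.

(** By strictness of [r], the filtrations of [L] are the images of those of [H],
    so that any factorization of [g] respects them. *)
Lemma mhs_descend (H L T : mhs R) (r : mhs_hom H L) (g : mhs_hom H T) :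
    (forall z, exists y, fZ r y = z) -> (forall x, fZ r x = 0 -> fZ g x = 0) ->
  exists u : mhs_hom L T, forall x, fZ u (fZ r x) = fZ g x.
Proof.
move=> rS rg; have /choice[s rs] := rS.
pose u0 z := fZ g (s z).
have ur x : u0 (fZ r x) = fZ g x.
  apply/eqP; rewrite -subr_eq0 -raddfB; apply/eqP/rg.
  by rewrite raddfB rs subrr.
have uB : zmod_morphism u0.
  move=> z t; have [x <-] := rS z; have [y <-] := rS t.
  by rewrite -raddfB !ur raddfB.
pose u := HB.pack_for {additive HZ L -> HZ T} u0
  (GRing.isZmodMorphism.Build _ _ u0 uB).
have tur (K : numFieldType) x :
    tens_lfun K u (tens_lfun K (fZ r) x) = tens_lfun K (fZ g) x.
  by apply: tens_lfun_compE; apply: ur.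
have lift (K : numFieldType) (z : tens (HZ L) K) : exists x, tens_lfun K (fZ r) x = z.
  have := memvf z; rewrite -(tens_surjective K rS) => /memv_imgP[x _ ->].
  by exists x.
have uW n : (tens_lfun rat u @: weight L n <= weight T n)%VS.
  apply/subvP => _ /memv_imgP[z zW ->]; have [x Ex] := lift _ z.
  have [|a aW Ea] := @mhs_strict_weight _ _ r n x; first by rewrite /fQ Ex.
  by rewrite -Ex -[tens_lfun rat (fZ r) x]Ea /fQ tur; apply: (fQ_weight g aW).
have uF p : (tens_lfun C u @: hodge L p <= hodge T p)%VS.
  apply/subvP => _ /memv_imgP[z zF ->]; have [x Ex] := lift _ z.
  have [|a aF Ea] := @mhs_strict_hodge _ _ r p x; first by rewrite /fC Ex.
  by rewrite -Ex -[tens_lfun C (fZ r) x]Ea /fC tur; apply: (fC_hodge g aF).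
by exists (@MHSHom R L T u uW uF).
Qed.

End MixedHodge.

(** * Sequences of vector spaces *)

Section LinearFactor.
Variable K : fieldType.

Definition lfun_of (U V : vectType K) (f : U -> V) (fL : linear f) : 'Hom(U, V) :=
  linfun (HB.pack_for {linear U -> V} f (GRing.isLinear.Build K U V _ f fL)).

Lemma lfun_ofE (U V : vectType K) (f : U -> V) (fL : linear f) : lfun_of fL =1 f.
Proof. by move=> x; rewrite lfunE. Qed.

Lemma lfun_lift (T U V : vectType K) (k : 'Hom(U, V)) (h : 'Hom(T, V)) :
  (forall x, exists y, k y = h x) -> forall x, k ((k^-1 \o h)%VF x) = h x.
Proof.
move=> kh x; rewrite comp_lfunE limg_lfunVK //.
by have [y <-] := kh x; rewrite memv_img ?memvf.
Qed.

Lemma lfun_descend (T U V : vectType K) (r : 'Hom(U, V)) (h : 'Hom(U, T)) :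
  (forall x, r x = 0 -> h x = 0) -> forall x, (h \o r^-1)%VF (r x) = h x.
Proof.
move=> rh x; rewrite comp_lfunE; apply/eqP; rewrite -subr_eq0 -lfunB.
apply/eqP/rh; rewrite lfunB -[r (_ (r x))]comp_lfunE.
by rewrite -[(r \o _)%VF (r x)]comp_lfunE inv_lfun_def subrr.
Qed.

Lemma fullv0P (V : vectType K) :
  (fullv : {vspace V}) = 0%VS <-> forall x : V, x = 0.
Proof.
split=> [V0 x|V0]; first by apply/eqP; rewrite -memv0 -V0 memvf.
by apply/vspaceP => x; rewrite [x]V0 !mem0v.
Qed.

Section Quotient.
Variables (V : vectType K) (U : {vspace V}).

(** The quotient of [V] by [U], realized as the complement on which [V] is
    projected along [U]. *)
Definition quotv : vectType K := subvs_of U^C.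

Fact quotv_proj_linear : linear (fun x => vsproj U^C (x - projv U x) : quotv).
Proof.
move=> a x y /=; rewrite -linearP; congr (vsproj _ _).
by rewrite linearP /= scalerBr opprD addrACA.
Qed.

Definition quotv_proj : 'Hom(V, quotv) := lfun_of quotv_proj_linear.

Lemma quotv_projP x : quotv_proj x = 0 <-> x \in U.
Proof.
rewrite lfun_ofE; split=> [/(congr1 vsval)|xU].
  rewrite vsprojK ?memv_projC // linear0 => /eqP.
  by rewrite subr_eq0 => /eqP->; apply: memv_proj.
by rewrite projv_id // subrr linear0.
Qed.

Lemma quotv_proj_surj z : exists x, quotv_proj x = z.
Proof.
exists (vsval z); rewrite lfun_ofE.
have -> : projv U (vsval z) = 0.
  by apply/eqP; rewrite -memv_ker lker_proj subvsP.
by rewrite subr0 vsvalK.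
Qed.

End Quotient.
End LinearFactor.

Section Vecs.
Variable R : realType.
Local Notation C := R[i].
Implicit Types V : vecs R.

Lemma vecs_kernel V V' (f : vecs_hom V V') :
  exists (L : vecs R) (k : vecs_hom L V),
    (forall j, injective (vmap k j)) /\ forall j, exact_at (vmap k j) (vmap f j).
Proof.
pose L j : vectType C := subvs_of (lker (vmap f j)).
pose k j : 'Hom(L j, vec V j) := linfun vsval.
have kE j x : k j x = vsval x by rewrite lfunE.
have kex j : exact_at (k j) (vmap f j).
  move=> x; split=> [fx0|[y <-]].
    have xK : x \in lker (vmap f j) by rewrite memv_ker fx0.
    by exists (vsproj _ x); rewrite kE vsprojK.
  by apply/eqP; rewrite kE -memv_ker subvsP.
have ktau j x : exists y, k (j - 1) y = (vtau V j \o k j)%VF x.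
  apply/kex; rewrite comp_lfunE -[vmap f _ _]comp_lfunE vmap_tau comp_lfunE.
  have -> : vmap f j (k j x) = 0 by apply/kex; exists x.
  exact: lfun0.
have Lb : exists s : seq int, forall j, j \notin s -> (fullv : {vspace L j}) = 0%VS.
  have [s sV] := vec_bounded V; exists s => j /sV/fullv0P V0.
  by apply/fullv0P => x; apply: subvs_inj; rewrite [LHS]V0 linear0.
exists (Vecs (fun j => ((k (j - 1))^-1 \o (vtau V j \o k j))%VF) Lb).
have kt j : (k (j - 1) \o ((k (j - 1))^-1 \o (vtau V j \o k j)) = vtau V j \o k j)%VF.
  by apply/lfunP => x; rewrite comp_lfunE lfun_lift.
exists (@VecsHom R (Vecs _ Lb) V k kt); split=> // j x y.
by rewrite !kE; apply: subvs_inj.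
Qed.

Lemma vecs_cokernel V V' (f : vecs_hom V V') :
  exists (L : vecs R) (r : vecs_hom V' L),
    (forall j z, exists y, vmap r j y = z) /\ forall j, exact_at (vmap f j) (vmap r j).
Proof.
pose L j : vectType C := quotv (limg (vmap f j)).
pose r j : 'Hom(vec V' j, L j) := quotv_proj (limg (vmap f j)).
have rS j z : exists y, r j y = z by apply: quotv_proj_surj.
have rex j : exact_at (vmap f j) (r j).
  move=> y; rewrite quotv_projP; split=> [/memv_imgP[x _ ->]|[x <-]].
    by exists x.
  by rewrite memv_img ?memvf.
have rtau j y : r j y = 0 -> (r (j - 1) \o vtau V' j)%VF y = 0.
  move=> /rex[x <-]; rewrite comp_lfunE; apply/rex; exists (vtau V j x).
  by rewrite -!comp_lfunE vmap_tau.
have Lb : exists s : seq int, forall j, j \notin s -> (fullv : {vspace L j}) = 0%VS.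
  have [s sV] := vec_bounded V'; exists s => j /sV/fullv0P V0.
  by apply/fullv0P => x; have [y <-] := rS j x; rewrite [y]V0 lfun0.
exists (Vecs (fun j => ((r (j - 1) \o vtau V' j) \o (r j)^-1)%VF) Lb).
have rt j : (r (j - 1) \o vtau V' j = ((r (j - 1) \o vtau V' j) \o (r j)^-1) \o r j)%VF.
  by apply/lfunP => x; rewrite [RHS]comp_lfunE lfun_descend //; apply: rtau.
by exists (@VecsHom R V' (Vecs _ Lb) r rt).
Qed.

Lemma vecs_biproduct V V' : exists (B : vecs R)
    (i1 : vecs_hom V B) (i2 : vecs_hom V' B) (p1 : vecs_hom B V) (p2 : vecs_hom B V'),
  forall j, [/\ forall x, vmap p1 j (vmap i1 j x) = x,
    forall x, vmap p2 j (vmap i2 j x) = x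
    & forall x, vmap i1 j (vmap p1 j x) + vmap i2 j (vmap p2 j x) = x].
Proof.
pose B j : vectType C := (vec V j * vec V' j)%type.
have i1L j : linear (fun x : vec V j => (x, 0) : B j).
  by move=> a x y; congr pair; rewrite /= scaler0 addr0.
have i2L j : linear (fun x : vec V' j => (0, x) : B j).
  by move=> a x y; congr pair; rewrite /= scaler0 addr0.
have p1L j : linear (fun x : B j => x.1) by [].
have p2L j : linear (fun x : B j => x.2) by [].
have tL j : linear (fun x : B j => (vtau V j x.1, vtau V' j x.2) : B (j - 1)).
  by move=> a x y; congr pair; rewrite linearP.
have Bb : exists s : seq int, forall j, j \notin s -> (fullv : {vspace B j}) = 0%VS.
  have [s sV] := vec_bounded V; have [t tV] := vec_bounded V'.
  exists (s ++ t) => j; rewrite mem_cat negb_or => /andP[/sV/fullv0P V0 /tV/fullv0P V'0].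
  by apply/fullv0P => -[x y]; rewrite [x]V0 [y]V'0.
pose S := Vecs (fun j => lfun_of (tL j)) Bb.
have i1t j : (lfun_of (i1L (j - 1)) \o vtau V j = vtau S j \o lfun_of (i1L j))%VF.
  by apply/lfunP => x; rewrite !comp_lfunE !lfun_ofE /= lfun0.
have i2t j : (lfun_of (i2L (j - 1)) \o vtau V' j = vtau S j \o lfun_of (i2L j))%VF.
  by apply/lfunP => x; rewrite !comp_lfunE !lfun_ofE /= lfun0.
have p1t j : (lfun_of (p1L (j - 1)%R) \o vtau S j = vtau V j \o lfun_of (p1L j))%VF.
  by apply/lfunP => x; rewrite !comp_lfunE !lfun_ofE.
have p2t j : (lfun_of (p2L (j - 1)%R) \o vtau S j = vtau V' j \o lfun_of (p2L j))%VF.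
  by apply/lfunP => x; rewrite !comp_lfunE !lfun_ofE.
exists S, (@VecsHom R V S _ i1t), (@VecsHom R V' S _ i2t).
exists (@VecsHom R S V _ p1t), (@VecsHom R S V' _ p2t) => j.
split=> x /=; rewrite !lfun_ofE //.
by case: x => x y; congr pair; rewrite /= ?addr0 ?add0r.
Qed.

Lemma vecs_zero : exists Z : vecs R, forall j (x : vec Z j), x = 0.
Proof.
pose Z (j : int) : vectType C := 'rV[C]_0.
have Z0 j (x : Z j) : x = 0 by apply: thinmx0.
have Zb : exists s : seq int, forall j, j \notin s -> (fullv : {vspace Z j}) = 0%VS.
  by exists [::] => j _; apply/fullv0P/Z0.
by exists (@Vecs R Z (fun j => 0) Zb).
Qed.

Lemma vecs_lift L V T (k : vecs_hom L V) (g : vecs_hom T V) :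
    (forall j, injective (vmap k j)) ->
    (forall j x, exists y, vmap k j y = vmap g j x) ->
  exists u : vecs_hom T L, forall j x, vmap k j (vmap u j x) = vmap g j x.
Proof.
move=> kI kg; pose u j := ((vmap k j)^-1 \o vmap g j)%VF.
have ku j x : vmap k j (u j x) = vmap g j x by apply: lfun_lift.
move: u ku => u ku.
suff ut j : (u (j - 1) \o vtau T j = vtau L j \o u j)%VF.
  by exists (VecsHom ut).
apply/lfunP => x; apply: (kI (j - 1)); rewrite !comp_lfunE ku.
rewrite -[LHS]comp_lfunE vmap_tau -[RHS]comp_lfunE vmap_tau.
by rewrite !comp_lfunE ku.
Qed.

Lemma vecs_descend V L T (r : vecs_hom V L) (g : vecs_hom V T) :
    (forall j z, exists y, vmap r j y = z) ->
    (forall j x, vmap r j x = 0 -> vmap g j x = 0) ->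
  exists u : vecs_hom L T, forall j x, vmap u j (vmap r j x) = vmap g j x.
Proof.
move=> rS rg; pose u j := (vmap g j \o (vmap r j)^-1)%VF.
have ur j x : u j (vmap r j x) = vmap g j x by apply: lfun_descend; apply: rg.
move: u ur => u ur.
suff ut j : (u (j - 1) \o vtau L j = vtau T j \o u j)%VF.
  by exists (VecsHom ut).
apply/lfunP => z; have [x <-] := rS j z; rewrite !comp_lfunE ur.
rewrite -[vtau L j _]comp_lfunE -vmap_tau comp_lfunE ur.
by rewrite -comp_lfunE vmap_tau comp_lfunE.
Qed.

End Vecs.

(** * Mixed Hodge structures with modulus *)

Section Modulus.
Variable R : realType.
Local Notation C := R[i].

Section Elementwise.
Variables (H : mhs R) (A I : vecs R).
Variable F : forall k, {vspace mhsm_space H A I k}.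

Lemma mem_sub_HC k x :
  (x \in sub_HC H A I k) = (x.1.2 == 0) && (x.2 == 0).
Proof.
apply/idP/andP=> [/memv_imgP[y _ ->]|[/eqP x12 /eqP x2]].
  by rewrite dsumE /= !zero_lfunE.
apply/memv_imgP; exists x; first exact: memvf.
rewrite dsumE !zero_lfunE id_lfunE.
by case: x x12 x2 => [[a v] w] /= -> ->.
Qed.

Lemma mem_sub_add k x :
  (x \in sub_add H A I k) = (x.1.1 == 0) && (x.2 == 0).
Proof.
apply/idP/andP=> [/memv_imgP[y _ ->]|[/eqP x11 /eqP x2]].
  by rewrite dsumE /= !zero_lfunE.
apply/memv_imgP; exists x; first exact: memvf.
rewrite dsumE !zero_lfunE id_lfunE.
by case: x x11 x2 => [[a v] w] /= -> ->.
Qed.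

Lemma F_fullP k : fullv = (F k + sub_HC H A I k + sub_add H A I k)%VS <->
  forall w, exists a v, (a, v, w) \in F k.
Proof.
split=> [E w|Fw].
  have := memvf ((0, 0, w) : mhsm_space H A I k).
  rewrite E => /memv_addP[_ /memv_addP[[[a v] w'] aF [y yH ->]] [z zA Ew]].
  exists a, v; move: Ew yH zA; rewrite mem_sub_HC mem_sub_add.
  case: y => [[? ?] y2]; case: z => [[? ?] z2] /= [_ _ ->].
  by move=> /andP[_ /eqP->] /andP[_ /eqP->]; rewrite !addr0.
apply/vspaceP => -[[a v] w]; rewrite memvf; have [b [u bF]] := Fw w.
have -> : (a, v, w) = (b, u, w) + (a - b, 0, 0) + (0, v - u, 0) :> mhsm_space H A I k.
  congr (_, _, _) => /=; last by rewrite !addr0.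
    by rewrite addr0 addrC subrK.
  by rewrite addr0 addrC subrK.
by rewrite !memv_add // ?mem_sub_HC ?mem_sub_add /= !eqxx.
Qed.

Lemma F_addP k : (sub_add H A I k :&: F k)%VS = 0%VS <->
  forall v, (0, v, 0) \in F k -> v = 0.
Proof.
split=> [E v vF|Fv].
  have: (0, v, 0) \in (sub_add H A I k :&: F k)%VS.
    by rewrite memv_cap mem_sub_add !eqxx.
  by rewrite E memv0 => /eqP[].
apply/eqP; rewrite -subv0; apply/subvP => -[[a v] w].
rewrite memv_cap mem_sub_add memv0 /= => /andP[/andP[/eqP-> /eqP->] /Fv->].
exact: eqxx.
Qed.

Lemma F_tauP k : (mhsm_tau H A I k @: F k <= F (k - 1))%VS <->
  forall a v w, (a, v, w) \in F k -> (a, vtau A k v, vtau I k w) \in F (k - 1).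
Proof.
split=> [/subvP Ft a v w aF|Ft].
  by have := Ft _ (memv_img _ aF); rewrite dsumE id_lfunE.
apply/subvP => _ /memv_imgP[[[a v] w] aF ->].
by rewrite dsumE id_lfunE; apply: Ft.
Qed.

End Elementwise.

Implicit Types X Y Z T : mhsm R.

Section Elements.
Variables (X : mhsm R) (k : int).

Lemma mhsm_tauE a v w : (a, v, w) \in mhsm_F X k ->
  (a, vtau (mhsm_add X) k v, vtau (mhsm_inf X) k w) \in mhsm_F X (k - 1).
Proof. exact: ((F_tauP (@mhsm_F _ X) k).1 (mhsm_F_tau X k)). Qed.

Lemma mhsm_fullE w : exists a v, (a, v, w) \in mhsm_F X k.
Proof. exact: ((F_fullP (@mhsm_F _ X) k).1 (mhsm_F_full X k)). Qed.

Lemma mhsm_addE v : (0, v, 0) \in mhsm_F X k -> v = 0.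
Proof. exact: ((F_addP (@mhsm_F _ X) k).1 (mhsm_F_add X k)). Qed.

End Elements.

Definition mhsm_of (H : mhs R) (A I : vecs R)
    (F : forall k, {vspace mhsm_space H A I k})
    (Ftau : forall k a v w, (a, v, w) \in F k ->
      (a, vtau A k v, vtau I k w) \in F (k - 1))
    (Fhodge : forall k x, x \in hodge H k <-> exists v, (x, v, 0) \in F k)
    (Ffull : forall k w, exists a v, (a, v, w) \in F k)
    (Fadd : forall k v, (0, v, 0) \in F k -> v = 0) : mhsm R :=
  MHSM (fun k => (F_tauP F k).2 (Ftau k)) Fhodge
    (fun k => (F_fullP F k).2 (Ffull k)) (fun k => (F_addP F k).2 (Fadd k)).

Lemma mhsm_subE X k (a b : HC (mhsm_H X)) (v u : vec (mhsm_add X) k)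
    (w t : vec (mhsm_inf X) k) :
  (a, v, w) - (b, u, t) = (a - b, v - u, w - t) :> mhsm_total X k.
Proof. by []. Qed.

Lemma mhsm_mapE X Y (f : mhsm_hom X Y) k a v w : mhsm_map f k (a, v, w) =
  (fC (hom_H f) a, vmap (hom_add f) k v, vmap (hom_inf f) k w).
Proof. exact: dsumE. Qed.

Lemma total_mapP X Y (fH : mhs_hom (mhsm_H X) (mhsm_H Y))
    (fa : vecs_hom (mhsm_add X) (mhsm_add Y))
    (fi : vecs_hom (mhsm_inf X) (mhsm_inf Y)) k :
  (total_map fH fa fi k @: mhsm_F X k <= mhsm_F Y k)%VS <->
  forall a v w, (a, v, w) \in mhsm_F X k ->
    (fC fH a, vmap fa k v, vmap fi k w) \in mhsm_F Y k.
Proof.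
split=> [/subvP fF a v w aF|fF].
  by have := fF _ (memv_img _ aF); rewrite dsumE.
apply/subvP => _ /memv_imgP[[[a v] w] aF ->].
by rewrite dsumE; apply: fF.
Qed.

Lemma mhsm_mapF X Y (f : mhsm_hom X Y) k a v w : (a, v, w) \in mhsm_F X k ->
  (fC (hom_H f) a, vmap (hom_add f) k v, vmap (hom_inf f) k w) \in mhsm_F Y k.
Proof. exact: ((total_mapP _ _ _ k).1 (hom_F f k)). Qed.

(** * Strictness *)

(** Lift the component [w] of the preimage [x] to some [z] in [mhsm_F X k]. Then
    the infinitesimal component of [f (x - z)] is 0, so its first component is
    in the Hodge filtration, where strictness for mixed Hodge structures
    gives a preimage [b]; lift [b] to [(b, u, 0)] in [mhsm_F X k]. What remains
    of [f x] is additive, hence 0. *)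
Lemma mhsm_strict_elt X Y (f : mhsm_hom X Y) k x :
  mhsm_map f k x \in mhsm_F Y k ->
  exists2 y, y \in mhsm_F X k & mhsm_map f k y = mhsm_map f k x.
Proof.
case: x => [[a v] w] fxF; have [a0 [v0 zF]] := mhsm_fullE w.
pose d : mhsm_total X k := (a - a0, v - v0, 0).
have xE : (a, v, w) = (a0, v0, w) + d :> mhsm_total X k.
  by congr (_, _, _); rewrite /= ?addr0 // addrC subrK.
have fzF : mhsm_map f k (a0, v0, w) \in mhsm_F Y k.
  by rewrite mhsm_mapE; apply: mhsm_mapF.
have fdF : mhsm_map f k d \in mhsm_F Y k.
  have -> : mhsm_map f k d = mhsm_map f k (a, v, w) - mhsm_map f k (a0, v0, w).
    by rewrite xE lfunD addrC addKr.
  exact: memvB.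
have fdE := mhsm_mapE f (a - a0) (v - v0) (0 : vec (mhsm_inf X) k).
rewrite lfun0 -/d in fdE.
have faF : fC (hom_H f) (a - a0) \in hodge (mhsm_H Y) k.
  by apply/mhsm_F_hodge; exists (vmap (hom_add f) k (v - v0)); rewrite -fdE.
have [b bF fb] := mhs_strict_hodge faF.
have [u uF] := (mhsm_F_hodge k b).1 bF.
pose y : mhsm_total X k := (b, u, 0).
have fyE := mhsm_mapE f b u (0 : vec (mhsm_inf X) k); rewrite lfun0 -/y in fyE.
exists ((a0, v0, w) + y); first exact: memvD.
rewrite xE !lfunD; congr (_ + _).
have fyF : mhsm_map f k y \in mhsm_F Y k by apply: (subvP (hom_F f k)); apply: memv_img.
have fyd : mhsm_map f k y - mhsm_map f k d =
    (0, vmap (hom_add f) k u - vmap (hom_add f) k (v - v0), 0).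
  by rewrite fyE fdE fb mhsm_subE !subrr.
have := memvB fyF fdF; rewrite fyd => /mhsm_addE/eqP; rewrite subr_eq0 => /eqP E.
by rewrite fyE fdE fb E.
Qed.

Lemma mhsm_strict X Y (f : mhsm_hom X Y) k :
  (mhsm_map f k @: mhsm_F X k = mhsm_F Y k :&: limg (mhsm_map f k))%VS.
Proof.
apply/eqP; rewrite eqEsubv subv_cap; apply/andP; split.
  by rewrite limgS ?subvf // andbT; apply: (hom_F f).
apply/subvP => y /memv_capP[yF /memv_imgP[x _ E]]; rewrite E in yF *.
by have [z zF <-] := mhsm_strict_elt yF; apply: memv_img.
Qed.

(** * Morphisms given componentwise *)

Lemma mhsm_hom_ext X Y (f g : mhsm_hom X Y) :
  (forall x, fZ (hom_H f) x = fZ (hom_H g) x) ->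
  (forall k x, vmap (hom_add f) k x = vmap (hom_add g) k x) ->
  (forall k x, vmap (hom_inf f) k x = vmap (hom_inf g) k x) -> f = g.
Proof.
move=> eH ea ei; apply: mhsm_hom_eq; first exact: mhs_hom_eq.
  by apply: vecs_hom_eq => k; apply/lfunP/ea.
by apply: vecs_hom_eq => k; apply/lfunP/ei.
Qed.

Definition mhsm_inj X Y (f : mhsm_hom X Y) : Prop :=
  [/\ injective (fZ (hom_H f)), forall k, injective (vmap (hom_add f) k)
    & forall k, injective (vmap (hom_inf f) k)].

Definition mhsm_surj X Y (f : mhsm_hom X Y) : Prop :=
  [/\ forall y, exists x, fZ (hom_H f) x = y,
    forall k y, exists x, vmap (hom_add f) k x = y
    & forall k y, exists x, vmap (hom_inf f) k x = y].

Definition mhsm_exact X Y Z (g : mhsm_hom X Y) (f : mhsm_hom Y Z) : Prop :=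
  [/\ exact_at (fZ (hom_H g)) (fZ (hom_H f)),
    forall k, exact_at (vmap (hom_add g) k) (vmap (hom_add f) k)
    & forall k, exact_at (vmap (hom_inf g) k) (vmap (hom_inf f) k)].

Lemma mhsm_map_inj X Y (f : mhsm_hom X Y) k :
  mhsm_inj f -> injective (mhsm_map f k).
Proof.
move=> [fH fa fi] [[a v] w] [[a' v'] w']; rewrite !mhsm_mapE.
by case=> /(fC_inj fH)-> /fa-> /fi->.
Qed.

(** By strictness of [k], a lift of [g] to the components of [X] automatically
    respects the Hodge filtration. *)
Lemma mhsm_lift X Y T (k : mhsm_hom X Y) (g : mhsm_hom T Y) : mhsm_inj k ->
    (forall t, exists x, fZ (hom_H k) x = fZ (hom_H g) t) ->
    (forall j t, exists x, vmap (hom_add k) j x = vmap (hom_add g) j t) ->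
    (forall j t, exists x, vmap (hom_inf k) j x = vmap (hom_inf g) j t) ->
  exists u : mhsm_hom T X, mhsm_comp k u = g.
Proof.
move=> kI gH ga gi; have [kH ka ki] := kI.
have [uH kuH] := mhs_lift kH gH; have [ua kua] := vecs_lift ka ga.
have [ui kui] := vecs_lift ki gi.
have uF j : (total_map uH ua ui j @: mhsm_F T j <= mhsm_F X j)%VS.
  apply/total_mapP => a v w tF.
  have kuC := fC_comp kuH a.
  have kuE : mhsm_map k j (fC uH a, vmap ua j v, vmap ui j w) =
      mhsm_map g j (a, v, w) by rewrite !mhsm_mapE kuC kua kui.
  have [|y yF] := @mhsm_strict_elt _ _ k j (fC uH a, vmap ua j v, vmap ui j w).
    by rewrite kuE mhsm_mapE mhsm_mapF.
  by move/(mhsm_map_inj kI) => <-.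
exists (MHSMHom uF); apply: mhsm_hom_ext => [x|j x|j x] /=; first exact: kuH.
  by rewrite comp_lfunE kua.
by rewrite comp_lfunE kui.
Qed.

(** By strictness of [r], the Hodge filtration of [Y] is the image of that of
    [X], so a componentwise factorization of [g] respects it. *)
Lemma mhsm_descend X Y T (r : mhsm_hom X Y) (g : mhsm_hom X T) : mhsm_surj r ->
    (forall x, fZ (hom_H r) x = 0 -> fZ (hom_H g) x = 0) ->
    (forall j x, vmap (hom_add r) j x = 0 -> vmap (hom_add g) j x = 0) ->
    (forall j x, vmap (hom_inf r) j x = 0 -> vmap (hom_inf g) j x = 0) ->
  exists u : mhsm_hom Y T, mhsm_comp u r = g.
Proof.
move=> [rH ra ri] gH ga gi.
have [uH urH] := mhs_descend rH gH; have [ua ura] := vecs_descend ra ga.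
have [ui uri] := vecs_descend ri gi.
have urC := fC_comp urH.
have uF j : (total_map uH ua ui j @: mhsm_F Y j <= mhsm_F T j)%VS.
  apply/total_mapP => a v w.
  have [a' <-] := fC_surj rH a.
  have [v' <-] := ra j v; have [w' <-] := ri j w.
  rewrite -mhsm_mapE => /mhsm_strict_elt[[[a1 v1] w1] yF].
  rewrite !mhsm_mapE => -[<- <- <-].
  by rewrite urC ura uri; apply: mhsm_mapF.
exists (MHSMHom uF); apply: mhsm_hom_ext => [x|j x|j x] /=; first exact: urH.
  by rewrite comp_lfunE ura.
by rewrite comp_lfunE uri.
Qed.

(** * Kernels, cokernels, biproducts and the zero object *)

(** Give the componentwise kernel the induced Hodge filtration. An element of it
    is found by lifting the given component to [mhsm_F X], and then correcting
    the lift, as in the proof of strictness, until [f] kills it. *)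
Lemma mhsm_kernel X Y (f : mhsm_hom X Y) :
  exists (L : mhsm R) (k : mhsm_hom L X), mhsm_inj k /\ mhsm_exact k f.
Proof.
have [LH [kH [kHI kHE]]] := mhs_kernel (hom_H f).
have [La [ka [kaI kaE]]] := vecs_kernel (hom_add f).
have [Li [ki [kiI kiE]]] := vecs_kernel (hom_inf f).
pose K j : 'Hom(mhsm_space LH La Li j, mhsm_total X j) :=
  dsum (fC kH) (vmap ka j) (vmap ki j).
pose F j := (K j @^-1: mhsm_F X j)%VS.
have memF j a v w : ((a, v, w) \in F j) =
    ((fC kH a, vmap ka j v, vmap ki j w) \in mhsm_F X j).
  by rewrite -memv_preim dsumE.
have fkC a : fC (hom_H f) (fC kH a) = 0.
  by apply/eqP; rewrite -memv_ker (fC_exact kHE) memv_img ?memvf.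
have liftC a : fC (hom_H f) a = 0 -> exists b, fC kH b = a.
  by move/eqP; rewrite -memv_ker (fC_exact kHE) => /memv_imgP[b _ ->]; exists b.
have fka j v : vmap (hom_add f) j (vmap ka j v) = 0 by apply/kaE; exists v.
have fki j w : vmap (hom_inf f) j (vmap ki j w) = 0 by apply/kiE; exists w.
(* The image under f is purely additive and in the Hodge filtration, hence 0. *)
have killed j a v w : (a, v, w) \in mhsm_F X j -> fC (hom_H f) a = 0 ->
    vmap (hom_inf f) j w = 0 -> exists u, vmap ka j u = v.
  move=> /(mhsm_mapF f) + fa0 fw0; rewrite fa0 fw0 => /mhsm_addE fv0.
  exact/kaE.
have Ftau j a v w : (a, v, w) \in F j ->
    (a, vtau La j v, vtau Li j w) \in F (j - 1).
  rewrite !memF -[vmap ka (j - 1) _]comp_lfunE -[vmap ki (j - 1) _]comp_lfunE.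
  by rewrite !vmap_tau !comp_lfunE; apply: mhsm_tauE.
have Fhodge j a : a \in hodge LH j <-> exists v, (a, v, 0) \in F j.
  split=> [/(fC_hodge kH)/mhsm_F_hodge[v vF]|[v]].
    have [//|u uv] := killed _ _ _ _ vF (fkC a); first exact: lfun0.
    by exists u; rewrite memF uv lfun0.
  rewrite memF lfun0 => aF.
  have /mhs_strict_hodge[b bF /(fC_inj kHI) <-//] :
    fC kH a \in hodge (mhsm_H X) j by apply/mhsm_F_hodge; exists (vmap ka j v).
have Ffull j w : exists a v, (a, v, w) \in F j.
  have [a [v aF]] := mhsm_fullE (vmap ki j w).
  have faF : fC (hom_H f) a \in hodge (mhsm_H Y) j.
    apply/mhsm_F_hodge; exists (vmap (hom_add f) j v).
    by have := mhsm_mapF f aF; rewrite fki.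
  have [b bF fb] := mhs_strict_hodge faF.
  have [u uF] := (mhsm_F_hodge j b).1 bF.
  have dF : (a - b, v - u, vmap ki j w) \in mhsm_F X j.
    by have := memvB aF uF; rewrite mhsm_subE subr0.
  have fab : fC (hom_H f) (a - b) = 0 by rewrite lfunB fb subrr.
  have [c ca] := liftC _ fab; have [t tv] := killed _ _ _ _ dF fab (fki j w).
  by exists c, t; rewrite memF ca tv.
have Fadd j v : (0, v, 0) \in F j -> v = 0.
  rewrite memF !lfun0 => /mhsm_addE kv0; apply: (kaI j).
  by rewrite kv0 lfun0.
pose L := mhsm_of Ftau Fhodge Ffull Fadd.
have kF j : (total_map (X := L) (Y := X) kH ka ki j @: mhsm_F L j <= mhsm_F X j)%VS.
  by apply/total_mapP => a v w; rewrite memF.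
by exists L, (@MHSMHom R L X kH ka ki kF).
Qed.

(** Give the componentwise cokernel the image of the Hodge filtration. Its
    axioms concern elements some of whose components come from [X]; these
    components are removed by subtracting images of elements of [mhsm_F X]. *)
Lemma mhsm_cokernel X Y (f : mhsm_hom X Y) :
  exists (L : mhsm R) (r : mhsm_hom Y L), mhsm_surj r /\ mhsm_exact f r.
Proof.
have [LH [rH [rHS rHE]]] := mhs_cokernel (hom_H f).
have [La [ra [raS raE]]] := vecs_cokernel (hom_add f).
have [Li [ri [riS riE]]] := vecs_cokernel (hom_inf f).
pose K j : 'Hom(mhsm_total Y j, mhsm_space LH La Li j) :=
  dsum (fC rH) (vmap ra j) (vmap ri j).
pose F j := (K j @: mhsm_F Y j)%VS.
have memF j a v w : (a, v, w) \in mhsm_F Y j ->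
    (fC rH a, vmap ra j v, vmap ri j w) \in F j.
  by move=> aF; have := memv_img (K j) aF; rewrite dsumE.
have memFP j a v w : (a, v, w) \in F j -> exists a' v' w',
    [/\ (a', v', w') \in mhsm_F Y j, a = fC rH a', v = vmap ra j v'
      & w = vmap ri j w'].
  move=> /memv_imgP[[[a' v'] w'] aF]; rewrite dsumE => -[-> -> ->].
  by exists a', v', w'.
have rfC a : fC rH (fC (hom_H f) a) = 0.
  by apply/eqP; rewrite -memv_ker (fC_exact rHE) memv_img ?memvf.
have liftC a : fC rH a = 0 -> exists b, fC (hom_H f) b = a.
  by move/eqP; rewrite -memv_ker (fC_exact rHE) => /memv_imgP[b _ ->]; exists b.
have rfa j v : vmap ra j (vmap (hom_add f) j v) = 0 by apply/raE; exists v.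
(* Elements of mhsm_F X with any prescribed infinitesimal component exist, so
   their images can cancel one that comes from X. *)
have kill_inf j a v w : (a, v, w) \in mhsm_F Y j -> vmap ri j w = 0 ->
    exists a0 v0, (a - fC (hom_H f) a0, v - vmap (hom_add f) j v0, 0)
      \in mhsm_F Y j.
  move=> aF /riE[w0 Ew]; have [a0 [v0 /(mhsm_mapF f) fF]] := mhsm_fullE w0.
  by exists a0, v0; have := memvB aF fF; rewrite mhsm_subE Ew subrr.
have Ftau j a v w : (a, v, w) \in F j ->
    (a, vtau La j v, vtau Li j w) \in F (j - 1).
  move=> /memFP[a' [v' [w' [aF -> -> ->]]]].
  rewrite -[vtau La j _]comp_lfunE -[vtau Li j _]comp_lfunE -!vmap_tau !comp_lfunE.
  exact/memF/mhsm_tauE.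
have Fhodge j a : a \in hodge LH j <-> exists v, (a, v, 0) \in F j.
  split=> [aF|[_ /memFP[a' [v' [w' [aF -> _ /esym/(kill_inf _ _ _ _ aF)]]]]]].
    have [a0 Ea0] := fC_surj rHS a; rewrite -Ea0 in aF *; have [a' a'F Ea'] := mhs_strict_hodge aF.
    have [v vF] := (mhsm_F_hodge j a').1 a'F.
    exists (vmap ra j v); rewrite -[X in (X, _, _)]Ea' -[0](lfun0 (vmap ri j)).
    exact: memF.
  move=> [a0 [v0 dF]]; have -> : fC rH a' = fC rH (a' - fC (hom_H f) a0).
    by rewrite lfunB rfC subr0.
  apply: (fC_hodge rH); apply: (@mhsm_F_hodge R Y j _).2.
  by exists (v' - vmap (hom_add f) j v0).
have Ffull j w : exists a v, (a, v, w) \in F j.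
  have [w' <-] := riS j w; have [a [v aF]] := mhsm_fullE w'.
  by exists (fC rH a), (vmap ra j v); apply: memF.
have Fadd j v : (0, v, 0) \in F j -> v = 0.
  move=> /memFP[a [v' [w' [aF a0 -> /esym/(kill_inf _ _ _ _ aF)]]]].
  move=> [b [u dF]].
  have [|c Ec] := liftC (a - fC (hom_H f) b); first by rewrite lfunB rfC subr0.
  have cF : fC (hom_H f) c \in hodge (mhsm_H Y) j.
    by apply/mhsm_F_hodge; exists (v' - vmap (hom_add f) j u); rewrite Ec.
  have [d /mhsm_F_hodge[t /(mhsm_mapF f) tF] fd] := mhs_strict_hodge cF.
  rewrite lfun0 fd Ec in tF.
  have := memvB dF tF. rewrite mhsm_subE !subrr.
  move=> /mhsm_addE/(congr1 (vmap ra j)).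
  by rewrite !lfunB !rfa !subr0 lfun0.
pose L := mhsm_of Ftau Fhodge Ffull Fadd.
have rF j : (total_map (X := Y) (Y := L) rH ra ri j @: mhsm_F Y j <= mhsm_F L j)%VS.
  by apply/total_mapP => a v w /memF.
by exists L, (@MHSMHom R Y L rH ra ri rF).
Qed.

End Modulus.

Section Abelian.
Variable R : realType.
Local Notation C := R[i].
Implicit Types X Y Z T : mhsm R.

Lemma mhsm_biproduct X Y : exists (B : mhsm R)
    (i1 : mhsm_hom X B) (i2 : mhsm_hom Y B) (p1 : mhsm_hom B X) (p2 : mhsm_hom B Y),
  [/\ [/\ forall x, fZ (hom_H p1) (fZ (hom_H i1) x) = x,
        forall x, fZ (hom_H p2) (fZ (hom_H i2) x) = x
      & forall x, fZ (hom_H i1) (fZ (hom_H p1) x) +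
          fZ (hom_H i2) (fZ (hom_H p2) x) = x],
    forall j, [/\ forall x, vmap (hom_add p1) j (vmap (hom_add i1) j x) = x,
        forall x, vmap (hom_add p2) j (vmap (hom_add i2) j x) = x
      & forall x, vmap (hom_add i1) j (vmap (hom_add p1) j x) +
          vmap (hom_add i2) j (vmap (hom_add p2) j x) = x]
  & forall j, [/\ forall x, vmap (hom_inf p1) j (vmap (hom_inf i1) j x) = x,
        forall x, vmap (hom_inf p2) j (vmap (hom_inf i2) j x) = x
      & forall x, vmap (hom_inf i1) j (vmap (hom_inf p1) j x) +
          vmap (hom_inf i2) j (vmap (hom_inf p2) j x) = x]].
Proof.
have [BH [i1H [i2H [p1H [p2H [H1 H2 H3]]]]]] := mhs_biproduct (mhsm_H X) (mhsm_H Y).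
have [Ba [i1a [i2a [p1a [p2a aP]]]]] := vecs_biproduct (mhsm_add X) (mhsm_add Y).
have [Bi [i1i [i2i [p1i [p2i iP]]]]] := vecs_biproduct (mhsm_inf X) (mhsm_inf Y).
have C1 : cancel (fC i1H) (fC p1H) by apply: tens_lfunK.
have C2 : cancel (fC i2H) (fC p2H) by apply: tens_lfunK.
have C3 a : fC i1H (fC p1H a) + fC i2H (fC p2H a) = a by apply: tens_lfun_biprod.
pose I1 j : 'Hom(mhsm_total X j, mhsm_space BH Ba Bi j) :=
  dsum (fC i1H) (vmap i1a j) (vmap i1i j).
pose I2 j : 'Hom(mhsm_total Y j, mhsm_space BH Ba Bi j) :=
  dsum (fC i2H) (vmap i2a j) (vmap i2i j).
pose P1 j : 'Hom(mhsm_space BH Ba Bi j, mhsm_total X j) :=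
  dsum (fC p1H) (vmap p1a j) (vmap p1i j).
pose P2 j : 'Hom(mhsm_space BH Ba Bi j, mhsm_total Y j) :=
  dsum (fC p2H) (vmap p2a j) (vmap p2i j).
pose F j := (I1 j @: mhsm_F X j + I2 j @: mhsm_F Y j)%VS.
have memF j a v w : ((a, v, w) \in F j) =
    ((fC p1H a, vmap p1a j v, vmap p1i j w) \in mhsm_F X j) &&
    ((fC p2H a, vmap p2a j v, vmap p2i j w) \in mhsm_F Y j).
  have [a1 a2 a3] := aP j; have [b1 b2 b3] := iP j.
  rewrite (@memv_biprod _ _ _ _ (I1 j) (I2 j) (P1 j) (P2 j)); first by rewrite !dsumE.
  - by move=> [[? ?] ?]; rewrite !dsumE C1 a1 b1.
  - by move=> [[? ?] ?]; rewrite !dsumE C2 a2 b2.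
  - by move=> [[x y] z]; rewrite !dsumE; congr (_, _, _); [exact: C3 | exact: a3 | exact: b3].
have Ftau j a v w : (a, v, w) \in F j ->
    (a, vtau Ba j v, vtau Bi j w) \in F (j - 1).
  rewrite !memF -[vmap p1a (j - 1) _]comp_lfunE -[vmap p1i (j - 1) _]comp_lfunE.
  rewrite -[vmap p2a (j - 1) _]comp_lfunE -[vmap p2i (j - 1) _]comp_lfunE.
  rewrite !vmap_tau !comp_lfunE => /andP[aX aY].
  by apply/andP; split; apply: mhsm_tauE.
have Fhodge j a : a \in hodge BH j <-> exists v, (a, v, 0) \in F j.
  have [a1 a2 a3] := aP j; have [b1 b2 b3] := iP j.
  split=> [aF|[v]].
    have [v1 v1F] := (mhsm_F_hodge j _).1 (fC_hodge p1H aF).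
    have [v2 v2F] := (mhsm_F_hodge j _).1 (fC_hodge p2H aF).
    exists (vmap i1a j v1 + vmap i2a j v2); rewrite memF !lfun0 !lfunD a1 a2.
    rewrite (biprod_cross1 a1 a2 a3) (biprod_cross2 a1 a2 a3) addr0 add0r.
    by rewrite v1F.
  rewrite memF !lfun0 => /andP[aX aY].
  have /(fC_hodge i1H) a1F : fC p1H a \in hodge (mhsm_H X) j.
    by apply/mhsm_F_hodge; exists (vmap p1a j v).
  have /(fC_hodge i2H) a2F : fC p2H a \in hodge (mhsm_H Y) j.
    by apply/mhsm_F_hodge; exists (vmap p2a j v).
  by rewrite -[a]C3 memvD.
have Ffull j w : exists a v, (a, v, w) \in F j.
  have [x1 [v1 vX]] := mhsm_fullE (vmap p1i j w).
  have [x2 [v2 vY]] := mhsm_fullE (vmap p2i j w).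
  have [a1 a2 a3] := aP j; have [b1 b2 b3] := iP j.
  exists (fC i1H x1 + fC i2H x2), (vmap i1a j v1 + vmap i2a j v2).
  rewrite memF !lfunD C1 C2 a1 a2.
  rewrite (biprod_cross1 a1 a2 a3) (biprod_cross2 a1 a2 a3).
  by rewrite (biprod_cross1 C1 C2 C3) (biprod_cross2 C1 C2 C3) !addr0 !add0r vX.
have Fadd j v : (0, v, 0) \in F j -> v = 0.
  have [a1 a2 a3] := aP j.
  rewrite memF !lfun0 => /andP[/mhsm_addE v1 /mhsm_addE v2].
  by rewrite -[v]a3 v1 v2 !lfun0 addr0.
pose B := mhsm_of Ftau Fhodge Ffull Fadd.
have i1F j : (total_map (X := X) (Y := B) i1H i1a i1i j @: mhsm_F X j <= mhsm_F B j)%VS.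
  exact: addvSl.
have i2F j : (total_map (X := Y) (Y := B) i2H i2a i2i j @: mhsm_F Y j <= mhsm_F B j)%VS.
  exact: addvSr.
have p1F j : (total_map (X := B) (Y := X) p1H p1a p1i j @: mhsm_F B j <= mhsm_F X j)%VS.
  by apply/total_mapP => a v w; rewrite memF => /andP[].
have p2F j : (total_map (X := B) (Y := Y) p2H p2a p2i j @: mhsm_F B j <= mhsm_F Y j)%VS.
  by apply/total_mapP => a v w; rewrite memF => /andP[].
exists B, (@MHSMHom R X B i1H i1a i1i i1F), (@MHSMHom R Y B i2H i2a i2i i2F).
by exists (@MHSMHom R B X p1H p1a p1i p1F), (@MHSMHom R B Y p2H p2a p2i p2F).
Qed.

Lemma mhsm_zero : exists Z : mhsm R, [/\ forall x : HZ (mhsm_H Z), x = 0,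
  forall j (v : vec (mhsm_add Z) j), v = 0 & forall j (v : vec (mhsm_inf Z) j), v = 0].
Proof.
have [ZH HZ0] := mhs_zero R; have [V V0] := vecs_zero R.
have HC0 (a : HC ZH) : a = 0 by apply: tens_trivial.
pose F j : {vspace mhsm_space ZH V V j} := fullv.
have Ftau j a v w : (a, v, w) \in F j ->
    (a, vtau V j v, vtau V j w) \in F (j - 1) by rewrite !memvf.
have Fhodge j a : a \in hodge ZH j <-> exists v, (a, v, 0) \in F j.
  by split=> _; [exists 0; apply: memvf | rewrite [a]HC0 mem0v].
have Ffull j w : exists a v, (a, v, w) \in F j by exists 0, 0; apply: memvf.
have Fadd j v : (0, v, 0) \in F j -> v = 0 by rewrite [v]V0.
by exists (mhsm_of Ftau Fhodge Ffull Fadd).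
Qed.

(** * The additive structure *)

Section AddMorphisms.
Variables (M N : fgZmodType) (K : numFieldType).
Variables (U : {vspace tens M K}) (U' : {vspace tens N K}).

Lemma tens_add_sub (f g : {additive M -> N}) :
  (tens_lfun K f @: U <= U')%VS -> (tens_lfun K g @: U <= U')%VS ->
  (tens_lfun K (f \+ g) @: U <= U')%VS.
Proof.
move=> /subvP fU /subvP gU; apply/subvP => _ /memv_imgP[x xU ->].
rewrite (@tens_lfunD _ _ _ f g) // add_lfunE.
by apply: memvD; [apply: fU | apply: gU]; apply: memv_img.
Qed.

Lemma tens_zero_sub : (tens_lfun K (\0 : M -> N) @: U <= U')%VS.
Proof. by rewrite tens_lfun0 // lim0g sub0v. Qed.

Lemma tens_opp_sub (f : {additive M -> N}) :
  (tens_lfun K f @: U <= U')%VS -> (tens_lfun K (\- f) @: U <= U')%VS.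
Proof.
move=> /subvP fU; apply/subvP => _ /memv_imgP[x xU ->].
have E : tens_lfun K (\- f) + tens_lfun K f = 0.
  transitivity (tens_lfun K (\0 : M -> N)); last exact: tens_lfun0.
  by apply/esym/tens_lfunD => y; rewrite /= addNr.
have -> : tens_lfun K (\- f) x = - tens_lfun K f x.
  by apply/eqP; rewrite -addr_eq0 -add_lfunE E zero_lfunE.
by rewrite memvN; apply: fU; apply: memv_img.
Qed.

End AddMorphisms.

Section Operations.
Variables H H' : mhs R.
Implicit Types f g : mhs_hom H H'.

Definition mhs_add f g : mhs_hom H H' := @MHSHom R H H' (fZ f \+ fZ g)
  (fun n => tens_add_sub (fZ_weight f n) (fZ_weight g n))
  (fun p => tens_add_sub (fZ_hodge f p) (fZ_hodge g p)).

Definition mhs_opp f : mhs_hom H H' := @MHSHom R H H' (\- fZ f)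
  (fun n => tens_opp_sub (fZ_weight f n)) (fun p => tens_opp_sub (fZ_hodge f p)).

Definition mhs_0 : mhs_hom H H' := @MHSHom R H H' (\0 : HZ H -> HZ H')
  (fun n => tens_zero_sub _ _) (fun p => tens_zero_sub _ _).

Lemma fC_add f g a : fC (mhs_add f g) a = fC f a + fC g a.
Proof. by rewrite /fC (@tens_lfunD _ _ _ (fZ f) (fZ g)) // add_lfunE. Qed.

Lemma fC_zero a : fC mhs_0 a = 0.
Proof. by rewrite /fC tens_lfun0 // zero_lfunE. Qed.

Lemma fC_opp f a : fC (mhs_opp f) a = - fC f a.
Proof.
apply/eqP; rewrite -addr_eq0 -fC_add -[X in _ == X](fC_zero a).
apply/eqP; congr (fC _ a); apply: mhs_hom_eq => x /=.
exact: addNr.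
Qed.

Variables V V' : vecs R.
Implicit Types u v : vecs_hom V V'.

Fact vecs_add_tau u v k : ((vmap u (k - 1) + vmap v (k - 1)) \o vtau V k
  = vtau V' k \o (vmap u k + vmap v k))%VF.
Proof. by rewrite comp_lfunDl comp_lfunDr !vmap_tau. Qed.

Fact vecs_opp_tau u k : (- vmap u (k - 1) \o vtau V k = vtau V' k \o (- vmap u k))%VF.
Proof. by rewrite comp_lfunNl comp_lfunNr vmap_tau. Qed.

Fact vecs_0_tau k : (0 \o vtau V k = vtau V' k \o (0 : 'Hom(vec V k, vec V' k)))%VF.
Proof. by rewrite comp_lfun0l comp_lfun0r. Qed.

Definition vecs_add u v : vecs_hom V V' := VecsHom (vecs_add_tau u v).
Definition vecs_opp u : vecs_hom V V' := VecsHom (vecs_opp_tau u).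
Definition vecs_0 : vecs_hom V V' := VecsHom vecs_0_tau.

End Operations.

Section ModulusOperations.
Variables X Y : mhsm R.
Implicit Types f g : mhsm_hom X Y.

Fact mhsm_add_F f g k :
  (total_map (mhs_add (hom_H f) (hom_H g)) (vecs_add (hom_add f) (hom_add g))
     (vecs_add (hom_inf f) (hom_inf g)) k @: mhsm_F X k <= mhsm_F Y k)%VS.
Proof.
apply/total_mapP => a v w aF; rewrite fC_add !add_lfunE.
exact: memvD (mhsm_mapF f aF) (mhsm_mapF g aF).
Qed.

Fact mhsm_opp_F f k :
  (total_map (mhs_opp (hom_H f)) (vecs_opp (hom_add f)) (vecs_opp (hom_inf f)) k
     @: mhsm_F X k <= mhsm_F Y k)%VS.
Proof.
apply/total_mapP => a v w aF; rewrite fC_opp !opp_lfunE.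
by have := mhsm_mapF f aF; rewrite -memvN.
Qed.

Fact mhsm_0_F k :
  (total_map (mhs_0 _ _) (vecs_0 _ _) (vecs_0 _ _) k @: mhsm_F X k <= mhsm_F Y k)%VS.
Proof.
by apply/total_mapP => a v w aF; rewrite fC_zero !zero_lfunE; apply: mem0v.
Qed.

Definition mhsm_madd f g : mhsm_hom X Y := MHSMHom (mhsm_add_F f g).
Definition mhsm_mopp f : mhsm_hom X Y := MHSMHom (mhsm_opp_F f).
Definition mhsm_m0 : mhsm_hom X Y := MHSMHom mhsm_0_F.

End ModulusOperations.

Definition MHSM_preadditive : preadditive (MHSM_category R).
Proof.
apply: (@Preadditive (MHSM_category R) mhsm_madd mhsm_mopp mhsm_m0).
- move=> X Y f g h; apply: mhsm_hom_ext => [x|k x|k x] /=; rewrite ?addrA //.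
- move=> X Y f g; apply: mhsm_hom_ext => [x|k x|k x] /=; first exact: addrC.
    by rewrite addrC.
  by rewrite addrC.
- move=> X Y f; apply: mhsm_hom_ext => [x|k x|k x] /=; first exact: add0r.
    by rewrite add0r.
  by rewrite add0r.
- move=> X Y f; apply: mhsm_hom_ext => [x|k x|k x] /=; first exact: addNr.
    by rewrite addNr.
  by rewrite addNr.
- move=> X Y Z g h f; apply: mhsm_hom_ext => [x|k x|k x] //=.
    by rewrite comp_lfunDl.
  by rewrite comp_lfunDl.
- move=> X Y Z g f h; apply: mhsm_hom_ext => [x|k x|k x] /=; first exact: raddfD.
    by rewrite comp_lfunDr.
  by rewrite comp_lfunDr.
Defined.

(** * Kernels and cokernels in the category *)

Local Notation MHSM := (MHSM_category R).
Local Notation Add := MHSM_preadditive.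

Lemma mhsm_eq0P X Y (f : mhsm_hom X Y) : f = mhsm_m0 X Y <->
  [/\ forall x, fZ (hom_H f) x = 0, forall k x, vmap (hom_add f) k x = 0
    & forall k x, vmap (hom_inf f) k x = 0].
Proof.
split=> [->|[fH fa fi]]; first by split=> *; rewrite ?zero_lfunE.
by apply: mhsm_hom_ext => *; rewrite ?zero_lfunE.
Qed.

Lemma mhsm_comp_eq0 X Y Z (g : mhsm_hom Y Z) (f : mhsm_hom X Y) :
  mhsm_exact f g -> mhsm_comp g f = mhsm_m0 X Z.
Proof.
move=> [eH ea ei]; apply/mhsm_eq0P; split=> [x|k x|k x] /=.
- by apply/eH; exists x.
- by rewrite comp_lfunE; apply/ea; exists x.
- by rewrite comp_lfunE; apply/ei; exists x.
Qed.

Lemma mhsm_inj_cancel X Y T (k : mhsm_hom X Y) (u v : mhsm_hom T X) :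
  mhsm_inj k -> mhsm_comp k u = mhsm_comp k v -> u = v.
Proof.
move=> [kH ka ki] E; apply: mhsm_hom_ext => [x|j x|j x].
- by apply: kH; have := congr1 (fun h => fZ (hom_H h) x) E.
- by apply: (ka j); have := congr1 (fun h => vmap (hom_add h) j x) E; rewrite !comp_lfunE.
- by apply: (ki j); have := congr1 (fun h => vmap (hom_inf h) j x) E; rewrite !comp_lfunE.
Qed.

Lemma mhsm_surj_cancel X Y T (r : mhsm_hom X Y) (u v : mhsm_hom Y T) :
  mhsm_surj r -> mhsm_comp u r = mhsm_comp v r -> u = v.
Proof.
move=> [rH ra ri] E; apply: mhsm_hom_ext => [x|j x|j x].
- by have [y <-] := rH x; have := congr1 (fun h => fZ (hom_H h) y) E.
- have [y <-] := ra j x.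
  by have := congr1 (fun h => vmap (hom_add h) j y) E; rewrite !comp_lfunE.
- have [y <-] := ri j x.
  by have := congr1 (fun h => vmap (hom_inf h) j y) E; rewrite !comp_lfunE.
Qed.

Lemma mhsm_is_kernel X Y Z (k : mhsm_hom X Y) (f : mhsm_hom Y Z) :
  mhsm_inj k -> mhsm_exact k f -> @kernel MHSM Add Y Z f X k.
Proof.
move=> kI kf; have [eH ea ei] := kf; split; first exact: mhsm_comp_eq0.
move=> T g /mhsm_eq0P[gH ga gi].
have [|||u ku] := mhsm_lift (g := g) kI.
- by move=> t; apply/eH; apply: gH.
- by move=> j t; apply/ea; have := ga j t; rewrite comp_lfunE.
- by move=> j t; apply/ei; have := gi j t; rewrite comp_lfunE.
by exists u; split=> // v kv; apply: (mhsm_inj_cancel kI); rewrite ku -kv.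
Qed.

Lemma mhsm_is_cokernel X Y Z (f : mhsm_hom X Y) (r : mhsm_hom Y Z) :
  mhsm_surj r -> mhsm_exact f r -> @cokernel MHSM Add X Y f Z r.
Proof.
move=> rS fr; have [eH ea ei] := fr; split; first exact: mhsm_comp_eq0.
move=> T g /mhsm_eq0P[gH ga gi].
have [|||u ur] := mhsm_descend (g := g) rS.
- by move=> y /eH[x <-]; apply: gH.
- by move=> j y /ea[x <-]; have := ga j x; rewrite comp_lfunE.
- by move=> j y /ei[x <-]; have := gi j x; rewrite comp_lfunE.
by exists u; split=> // v vr; apply: (mhsm_surj_cancel rS); rewrite ur -vr.
Qed.

Lemma inj_exact0 (A B D : zmodType) (g : {additive A -> B}) (f : {additive B -> D}) :
  exact_at g f -> (forall x, g x = 0) -> injective f.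
Proof.
move=> gf g0 x y fxy; apply/eqP; rewrite -subr_eq0; apply/eqP.
have /gf[z <-] : f (x - y) = 0 by rewrite raddfB fxy subrr.
exact: g0.
Qed.

(** The componentwise kernel maps to [X] by a morphism killed by [f], hence 0. *)
Lemma mhsm_monic_inj X Y (f : mhsm_hom X Y) : @Defs.monic MHSM X Y f -> mhsm_inj f.
Proof.
have [L [k [_ kf]]] := mhsm_kernel f; have [eH ea ei] := kf.
move=> /(_ L k (mhsm_m0 L X)); rewrite /= mhsm_comp_eq0 //.
have -> : mhsm_comp f (mhsm_m0 L X) = mhsm_m0 L Y.
  by apply/mhsm_eq0P; split=> *; rewrite /= ?raddf0 // comp_lfunE zero_lfunE lfun0.
move=> /(_ erefl)/mhsm_eq0P[kH ka ki]; split; first exact: inj_exact0 eH kH.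
  by move=> j; apply: inj_exact0 (ea j) (ka j).
by move=> j; apply: inj_exact0 (ei j) (ki j).
Qed.

(** The projection of [Y] to the componentwise cokernel kills [f], hence is 0. *)
Lemma mhsm_epic_surj X Y (f : mhsm_hom X Y) : @epic MHSM X Y f -> mhsm_surj f.
Proof.
have [L [r [_ fr]]] := mhsm_cokernel f; have [eH ea ei] := fr.
move=> /(_ L r (mhsm_m0 Y L)); rewrite /= mhsm_comp_eq0 //.
have -> : mhsm_comp (mhsm_m0 Y L) f = mhsm_m0 X L.
  by apply/mhsm_eq0P; split=> *; rewrite /= ?comp_lfunE ?zero_lfunE.
move=> /(_ erefl)/mhsm_eq0P[rH ra ri]; split=> [y|j y|j y].
- exact/eH/rH.
- exact/ea/ra.
- exact/ei/ri.
Qed.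

Lemma MHSM_abelian : abelian_category MHSM.
Proof.
exists Add; split; [|split; [|split; [|split; [|split]]]].
- have [Z [ZH Za Zi]] := mhsm_zero; exists Z => X; split.
    exists (mhsm_m0 Z X); split=> // f _; apply/esym/mhsm_eq0P.
    split=> [x|k x|k x]; first by rewrite [x]ZH raddf0.
      by rewrite [x]Za lfun0.
    by rewrite [x]Zi lfun0.
  exists (mhsm_m0 X Z); split=> // f _; apply/esym/mhsm_eq0P.
  by split=> *; [apply: ZH | apply: Za | apply: Zi].
- move=> X Y; have [B [i1 [i2 [p1 [p2 [[H1 H2 H3] Ba Bi]]]]]] := mhsm_biproduct X Y.
  exists B, i1, i2, p1, p2; split; apply: mhsm_hom_ext => [x|k x|k x] //=.
  + by have [E _ _] := Ba k; rewrite comp_lfunE id_lfunE E.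
  + by have [E _ _] := Bi k; rewrite comp_lfunE id_lfunE E.
  + by have [_ E _] := Ba k; rewrite comp_lfunE id_lfunE E.
  + by have [_ E _] := Bi k; rewrite comp_lfunE id_lfunE E.
  + by have [_ _ E] := Ba k; rewrite add_lfunE !comp_lfunE id_lfunE E.
  + by have [_ _ E] := Bi k; rewrite add_lfunE !comp_lfunE id_lfunE E.
- move=> X Y f; have [L [k [kI kf]]] := mhsm_kernel f.
  by exists L, k; apply: mhsm_is_kernel.
- move=> X Y f; have [L [r [rS fr]]] := mhsm_cokernel f.
  by exists L, r; apply: mhsm_is_cokernel.
- move=> X Y f /mhsm_monic_inj fI; have [L [r [_ fr]]] := mhsm_cokernel f.
  by exists L, r; apply: mhsm_is_kernel.
- move=> X Y f /mhsm_epic_surj fS; have [L [k [_ kf]]] := mhsm_kernel f.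
  by exists L, k; apply: mhsm_is_cokernel.
Qed.

End Abelian.

Theorem proposition3 (R : realType) :
  (forall (X Y : mhsm R) (f : mhsm_hom X Y) (k : int),
     (mhsm_map f k @: mhsm_F X k = mhsm_F Y k :&: limg (mhsm_map f k))%VS) /\
  abelian_category (MHSM_category R).
Proof. by split; [exact: mhsm_strict | exact: MHSM_abelian]. Qed.
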